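(* Let $n\ge 1$, $d\ge 1$, $\varepsilon,\delta\in(0,1)$ and $p\ge 1$. Let $\mu_1,\ldots,\mu_k$ be discrete probability distributions on $\mathbb{R}^d$ with $|\mathrm{supp}(\mu_i)|\le \mathrm{poly}(n)$ for all $i$. Let $\pi=\pi_{d,m}:\mathbb{R}^d\to\mathbb{R}^m$ be a random JL map with $m=O\!\left(\frac{p^4}{\varepsilon^2}\log\frac{n}{\varepsilon\delta}\right)$. Then \[\mathbb{P}\Big(\mathrm{cost}_p(\pi S)\in[(1-\varepsilon)\,\mathrm{cost}_p(S),\,(1+\varepsilon)\,\mathrm{cost}_p(S)]\ \text{for all solutions } S\Big)\ge 1-\delta .\]
   Context: The Wasserstein barycenter problem: given discrete distributions $\mu_1,\dots,\mu_k$ on $\mathbb{R}^d$, find a distribution $\nu=\sum_{j=1}^n b_j\delta_{\nu^j}$ with support size at most $n$ minimizing $\frac1k\sum_{i=1}^k W_p(\mu_i,\nu)^p$, where $W_p(\mu,\nu)^p=\inf_{\gamma}\int\|x-y\|^p\,d\gamma(x,y)$ over couplings $\gamma$ of $\mu,\nu$ ($\|\cdot\|$ Euclidean). Write $\mu_i=\sum_x a(x)\delta_x$ (the weight $a(x)$ implicitly depends on which $\mu_i$ the point $x$ comes from). A solution $(S,w)=(S_1,\dots,S_n,w_1,\dots,w_n)$ is obtained from the optimal couplings of each $\mu_i$ to a fixed $\nu$ supported on $n$ points: $w_j(x)\ge 0$ is the total mass sent from the point $x$ (of some $\mu_i$) to $\nu^j$, and $S_j=\{x\in\bigcup_i\mathrm{supp}(\mu_i):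 w_j(x)>0\}$. Its cost is $\mathrm{cost}_p(S)=\min_{\nu^1,\dots,\nu^n\in\mathbb{R}^d}\frac1k\sum_{j=1}^n\sum_{x\in S_j}w_j(x)\|x-\nu^j\|^p$, and for a map $\pi:\mathbb{R}^d\to\mathbb{R}^m$, $\mathrm{cost}_p(\pi S)=\min_{\tilde\nu^1,\dots,\tilde\nu^n\in\mathbb{R}^m}\frac1k\sum_{j=1}^n\sum_{x\in S_j}w_j(x)\|\pi(x)-\tilde\nu^j\|^p$ (same weights). A JL map is a random linear dimensionality reduction map satisfying the guarantee of the Johnson–Lindenstrauss lemma, e.g. an appropriately scaled random Gaussian or sub-Gaussian matrix.
   Formalization: The logarithm log(n/(εδ)) in the bound on m is replaced by max(1, log(n/(εδ))), and the JL map is required to satisfy P(|‖πx‖−‖x‖| > t‖x‖) ≤ 2exp(−c₀t²m) for all t > 0, including t ≥ 1; without these the claim fails. *)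

(* Defs.v *)
From HB Require Import structures.
From mathcomp Require Import all_boot all_order all_algebra.
From mathcomp Require Import finmap.
From mathcomp Require Import all_classical all_reals all_analysis.

Set Implicit Arguments.
Unset Strict Implicit.
Unset Printing Implicit Defensive.

Import Order.TTheory GRing.Theory Num.Theory.
Local Open Scope classical_set_scope.
Local Open Scope ring_scope.

(* The norm that the library puts on 'rV[R]_d is the sup norm. *)
Definition enorm (R : realType) (d : nat) (x : 'rV[R]_d) : R :=
  Num.sqrt (\sum_(i < d) x ord0 i ^+ 2).

(* A finitely supported distribution is given by its mass function, so that
   [finsupp] is its support. *)
Notation mass_fun R T := {fsfun T -> R with 0%R}.

Definition is_distr (R : realType) (T : choiceType) (mu : mass_fun R T) : Prop :=
  (forall x, 0 <= mu x) /\ \sum_(x <- finsupp mu) mu x = 1.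

Definition is_coupling (R : realType) (d : nat) (mu nu : mass_fun R 'rV[R]_d)
    (g : mass_fun R ('rV[R]_d * 'rV[R]_d)%type) : Prop :=
  [/\ forall z, 0 <= g z,
      forall x, \sum_(z <- finsupp g | z.1 == x) g z = mu x
    & forall y, \sum_(z <- finsupp g | z.2 == y) g z = nu y].

Definition transport_cost (R : realType) (d : nat) (p : R)
    (g : mass_fun R ('rV[R]_d * 'rV[R]_d)%type) : R :=
  \sum_(z <- finsupp g) g z * enorm (z.1 - z.2) `^ p.

(* W_p(mu, nu)^p *)
Definition wasserstein_pow (R : realType) (d : nat) (p : R)
    (mu nu : mass_fun R 'rV[R]_d) : R :=
  inf [set transport_cost p g | g in [set g | is_coupling mu nu g]].

Definition is_optimal_coupling (R : realType) (d : nat) (p : R)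
    (mu nu : mass_fun R 'rV[R]_d)
    (g : mass_fun R ('rV[R]_d * 'rV[R]_d)%type) : Prop :=
  is_coupling mu nu g /\ transport_cost p g = wasserstein_pow p mu nu.

(* [w j i x] is the weight w_j(x) of the point x, regarded as a point of mu_i:
   a point lying in the supports of several of the mu_i counts once for each
   of them. *)
Definition weights (R : realType) (d n k : nat) : Type :=
  'I_n -> 'I_k -> 'rV[R]_d -> R.

(* [S j] is represented by its part in each of the supports. *)
Definition cluster (R : realType) (d n k : nat)
    (mu : 'I_k -> mass_fun R 'rV[R]_d) (w : weights R d n k)
    (j : 'I_n) (i : 'I_k) : {fset 'rV[R]_d} :=
  [fset x in finsupp (mu i) | 0 < w j i x]%fset.

(* The points [pt j] are distinct, so that "the mass sent from x to [pt j]" is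
   unambiguous; some of them may have mass 0, so that nu is an arbitrary
   distribution whose support has at most n points. *)
Definition is_solution (R : realType) (d n k : nat) (p : R)
    (mu : 'I_k -> mass_fun R 'rV[R]_d) (w : weights R d n k) : Prop :=
  exists (nu : mass_fun R 'rV[R]_d) (pt : 'I_n -> 'rV[R]_d)
         (g : 'I_k -> mass_fun R ('rV[R]_d * 'rV[R]_d)%type),
    [/\ is_distr nu,
        injective pt,
        forall y, y \in finsupp nu -> exists j, y = pt j,
        forall i, is_optimal_coupling p (mu i) nu (g i)
      & forall j i x, w j i x = g i (x, pt j)].

(* cost_p(f S); the infimum is over a nonempty set of nonnegative reals. *)
Definition cost (R : realType) (d m n k : nat) (p : R)
    (mu : 'I_k -> mass_fun R 'rV[R]_d) (w : weights R d n k)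
    (f : 'rV[R]_d -> 'rV[R]_m) : R :=
  inf (range (fun c : 'I_n -> 'rV[R]_m =>
    k%:R^-1 * \sum_(j < n) \sum_(i < k) \sum_(x <- cluster mu w j i)
      w j i x * enorm (f x - c j) `^ p)).

(* A random matrix, acting on row vectors, with the distributional
   Johnson-Lindenstrauss guarantee with constant c0. For t < 1 this is the usual
   JL bound; for t >= 1 it is the sub-Gaussian tail of the distortion, which
   scaled Gaussian and sub-Gaussian matrices have, and without which the p-th
   powers of the distances need not be controlled when p > 2. *)
Definition is_JL_map (R : realType) (c0 : R) (disp : measure_display)
    (T : measurableType disp) (P : probability T R) (d m : nat)
    (M : T -> 'M[R]_(d, m)) : Prop :=
  (forall i j, measurable_fun [set: T] (fun w => M w i j)) /\
  (forall (x : 'rV[R]_d) (t : R), 0 < t ->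
     (P [set w | (t * enorm x < `| enorm (x *m M w) - enorm x |)%R]
        <= (2 * expR (- (c0 * t ^+ 2 * m%:R)))%:E)%E).

(* Main.v *)
Require Import Defs.
From mathcomp Require Import all_boot all_order all_algebra.
From mathcomp Require Import finmap ring lra.
From mathcomp Require Import all_classical all_reals all_analysis.
From mathcomp Require Import measurable_realfun.
Import Order.TTheory GRing.Theory Num.Theory.
Import numFieldNormedType.Exports.
Local Open Scope classical_set_scope.
Local Open Scope ring_scope.

Set Implicit Arguments.
Unset Strict Implicit.
Unset Printing Implicit Defensive.

(** The number of distributions does not enter the dimension because the points are never compared
    all at once.  Pool the [mu i] into one weighted finite point set, and fix [n] data points, the
    anchors, whose clustering cost [sum_x a x * r x ^ p] is within a factor [2 ^ p] of the cost of
    every solution; here [r x] is the distance from [x] to its own anchor.  By Markov's inequality,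
    with high probability all distances between anchors are preserved, the points whose distance to
    some anchor is distorted carry a tiny share of the anchor cost, and the distorted pairs of points
    carry a tiny share of the product measure [(a r ^ p) x (a r ^ p)].  Points of the first kind are
    moved to their anchors.

    A single cluster is then handled by a robust form of Kirszbraun's theorem: given a center [c] in
    one space, the center [c'] in the other space minimizes a convex energy in the slacks
    [|x' - c'| ^ 2 - L ^ 2 * |x - c| ^ 2] of the points and, with a huge weight, of the anchors.  The
    optimality condition says that [c'] is a barycenter of the points with positive slack, so that the
    total slack is bounded by the contribution of the distorted pairs.  Truncating the derivative of
    the energy keeps the multipliers below [a * r ^ (p - 2)], and an exchange with
    the anchors shows that the excess of a distorted pair is [O(r x * r y)]; by Cauchy-Schwarz the
    contribution is then controlled by the product measure of the distorted pairs. *)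

(** * Euclidean geometry and powers *)

Section Euclidean.
Variables (R : realType) (d : nat).
Implicit Types u v x y z : 'rV[R]_d.

Definition dot u v : R := \sum_(i < d) u ord0 i * v ord0 i.

Lemma dotC u v : dot u v = dot v u.
Proof. by apply: eq_bigr => i _; rewrite mulrC. Qed.

Lemma dotDl u v x : dot (u + v) x = dot u x + dot v x.
Proof. by rewrite -big_split; apply: eq_bigr => i _; rewrite mxE mulrDl. Qed.

Lemma dotZl (a : R) u v : dot (a *: u) v = a * dot u v.
Proof. by rewrite mulr_sumr; apply: eq_bigr => i _; rewrite mxE mulrA. Qed.

Lemma dotDr u v x : dot x (u + v) = dot x u + dot x v.
Proof. by rewrite dotC dotDl !(dotC x). Qed.

Lemma dotZr (a : R) u v : dot v (a *: u) = a * dot v u.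
Proof. by rewrite dotC dotZl dotC. Qed.

Lemma dotNl u v : dot (- u) v = - dot u v.
Proof. by rewrite -scaleN1r dotZl mulN1r. Qed.

Lemma dotNr u v : dot v (- u) = - dot v u.
Proof. by rewrite dotC dotNl dotC. Qed.

Lemma dot0l u : dot 0 u = 0.
Proof. by rewrite -(scale0r 0) dotZl mul0r. Qed.

Lemma dot_suml (I : finType) (f : I -> 'rV[R]_d) v :
  dot (\sum_i f i) v = \sum_i dot (f i) v.
Proof.
apply: (big_ind2 (fun a b => dot a v = b)); first exact: dot0l.
- by move=> x1 x2 y1 y2 <- <-; rewrite dotDl.
- by [].
Qed.

Lemma dot_ge0 u : 0 <= dot u u.
Proof. by apply: sumr_ge0 => i _; rewrite -expr2 sqr_ge0. Qed.

Lemma dot_eq0 u : dot u u = 0 -> u = 0.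
Proof.
move=> /eqP; rewrite psumr_eq0; last by move=> i _; rewrite -expr2 sqr_ge0.
move=> /allP h; apply/rowP => i; rewrite mxE.
by have /eqP := h i (mem_index_enum _); rewrite -expr2 => /eqP; rewrite sqrf_eq0 => /eqP.
Qed.

Lemma enormE u : enorm u = Num.sqrt (dot u u).
Proof. by []. Qed.

Lemma enorm_ge0 u : 0 <= enorm u.
Proof. exact: sqrtr_ge0. Qed.

Lemma sqr_enorm u : enorm u ^+ 2 = dot u u.
Proof. by rewrite enormE sqr_sqrtr// dot_ge0. Qed.

Lemma enorm0 : enorm (0 : 'rV[R]_d) = 0.
Proof. by rewrite enormE dot0l sqrtr0. Qed.

Lemma enormN u : enorm (- u) = enorm u.
Proof. by rewrite !enormE dotNl dotNr opprK. Qed.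

Lemma enormBC u v : enorm (u - v) = enorm (v - u).
Proof. by rewrite -enormN opprB. Qed.

(** Cauchy-Schwarz, from the nonnegative square of [enorm v *: u - enorm u *: v]. *)
Lemma dot_le_enorm u v : dot u v <= enorm u * enorm v.
Proof.
have [u0|] := eqVneq (enorm u) 0.
  have -> : u = 0 by apply: dot_eq0; rewrite -sqr_enorm u0 expr0n.
  by rewrite dot0l enorm0 mul0r.
have [v0|v0 u0] := eqVneq (enorm v) 0.
  have -> : v = 0 by apply: dot_eq0; rewrite -sqr_enorm v0 expr0n.
  by rewrite dotC dot0l enorm0 mulr0.
have u_gt0 : 0 < enorm u by rewrite lt_neqAle eq_sym u0 enorm_ge0.
have v_gt0 : 0 < enorm v by rewrite lt_neqAle eq_sym v0 enorm_ge0.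
have := dot_ge0 (enorm v *: u - enorm u *: v).
rewrite !(dotDl, dotDr, dotNl, dotNr, dotZl, dotZr) -!sqr_enorm (dotC v u).
set a := enorm u in u_gt0 *; set b := enorm v in v_gt0 *; set c := dot u v => h.
rewrite -subr_ge0 -(pmulr_rge0 _ (mulr_gt0 u_gt0 v_gt0)).
rewrite -(pmulr_rge0 _ (ltr0n R 2)); apply: le_trans h _; rewrite le_eqVlt; apply/orP; left; apply/eqP; ring.
Qed.

Lemma ler_enormD u v : enorm (u + v) <= enorm u + enorm v.
Proof.
rewrite -(@ler_pXn2r _ 2)// ?nnegrE ?addr_ge0 ?enorm_ge0//.
rewrite sqrrD !sqr_enorm dotDl !dotDr (dotC v u).
have := dot_le_enorm u v; set t := enorm u * enorm v; lra.
Qed.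

Lemma ler_enormB_trans y x z : enorm (x - z) <= enorm (x - y) + enorm (y - z).
Proof. by have := ler_enormD (x - y) (y - z); rewrite addrA subrK. Qed.

End Euclidean.

Section PowR.
Variable R : realType.
Implicit Types a b p t : R.

Lemma ler_powR2l p a b : 0 <= p -> 0 <= a -> a <= b -> a `^ p <= b `^ p.
Proof. by move=> p0 a0 ab; rewrite ge0_ler_powR// nnegrE ?(le_trans a0). Qed.

(** Convexity of the power: [a + b] is the combination of [(1 + t) * a] and [(1 + t^-1) * b] with
    weights [(1 + t)^-1] and [1 - (1 + t)^-1], which are then bounded by 1. A small [t] keeps the
    main term almost unchanged and charges a large factor to the error term. *)
Lemma powRD_le p t a b : 1 <= p -> 0 < t -> 0 <= a -> 0 <= b ->
  (a + b) `^ p <= (1 + t) `^ p * a `^ p + (1 + t^-1) `^ p * b `^ p.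
Proof.
move=> p1 t0 a0 b0.
have p0 : 0 <= p by lra.
have it0 : 0 < t^-1 by rewrite invr_gt0.
rewrite -!powRM ?addr_ge0 ?(ltW t0) ?(ltW it0)//.
have s01 : 0 <= (1 + t)^-1 <= 1 by rewrite invr_ge0 invf_le1 ?ltrDl ?lerDl ?ltW//; lra.
have := convex_powR p1 (Itv01 (andP s01).1 (andP s01).2).
move=> /(_ ((1 + t) * a) ((1 + t^-1) * b)).
rewrite !inE /= !in_itv /= !andbT !mulr_ge0//; [|lra..].
move=> /(_ isT isT); rewrite !convRE [X in X `^ _ <= _ -> _]convRE /=.
have -> : (1 + t)^-1 * ((1 + t) * a) = a by rewrite mulKf// gt_eqF//; lra.
have -> : (1 - (1 + t)^-1) * ((1 + t^-1) * b) = b by field; rewrite !gt_eqF//; lra.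
move=> /le_trans; apply; apply: lerD.
  by rewrite ler_piMl ?powR_ge0//; case/andP: s01.
by rewrite ler_piMl ?powR_ge0//; rewrite lerBlDr lerDl; case/andP: s01.
Qed.

End PowR.

(** * A truncated quadratic and its derivative *)

Section Huber.
Variable R : realType.
Implicit Types s t T l : R.

Definition clamp T s : R := Num.min (Num.max s 0) T.

(* Convex, with derivative [clamp T]. *)
Definition huber T s : R := clamp T s * s - clamp T s ^+ 2 / 2.

Variant clamp_spec T s : R -> Prop :=
| ClampNeg of s <= 0 : clamp_spec T s 0
| ClampMid of 0 <= s & s <= T : clamp_spec T s s
| ClampTop of 0 <= s & T <= s : clamp_spec T s T.

Lemma clampP T s : 0 <= T -> clamp_spec T s (clamp T s).
Proof.
move=> T0; rewrite /clamp; have [s0|s0] := leP s 0.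
  by rewrite min_l//; constructor.
by have [sT|sT] := leP s T; constructor => //; exact: ltW.
Qed.

Lemma clamp_ge0 T s : 0 <= T -> 0 <= clamp T s.
Proof. by move=> T0; case: (clampP s T0). Qed.

Lemma clamp_le T s : 0 <= T -> clamp T s <= T.
Proof. by move=> T0; case: (clampP s T0). Qed.

Lemma sqr_clamp_le T s : 0 <= T -> clamp T s ^+ 2 <= clamp T s * s.
Proof. by move=> T0; case: (clampP s T0) => *; nra. Qed.

Lemma clamp_top T s : 0 <= T -> T <= s -> clamp T s = T.
Proof. by move=> T0 Ts; rewrite /clamp max_l ?min_r// (le_trans T0). Qed.

(** [huber T] is a supremum of affine functions, one for each multiplier [l] in [[0, T]], attained
    at [l = clamp T s]. The choices [l = 0] and [l = T] give nonnegativity and linear growth. *)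
Lemma huber_max T s l : 0 <= l <= T -> l * s - l ^+ 2 / 2 <= huber T s.
Proof.
move=> /andP[l0 lT]; have T0 := le_trans l0 lT.
have := sqr_ge0 (s - l); have := sqr_ge0 (T - l).
rewrite /huber; case: (clampP s T0) => [s0|s0 sT|s0 sT].
- by have := mulr_ge0_le0 l0 s0; have := sqr_ge0 l; lra.
- by lra.
- by have : 0 <= (T - l) * (s - T); [rewrite mulr_ge0 ?subr_ge0|lra].
Qed.

Lemma clamp_lip T s t : 0 <= T -> `|clamp T s - clamp T t| <= `|s - t|.
Proof.
move=> T0; rewrite ler_norml; have := ler_norm (s - t).
have : t - s <= `|s - t| by rewrite distrC ler_norm.
have := normr_ge0 (s - t).
by case: (clampP s T0) => *; case: (clampP t T0) => *; lra.
Qed.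

(** The multiplier that is optimal at [s + e] is a competitor at [s], and it differs from the one at
    [s] by at most [|e|]. This second-order bound takes the place of differentiability. *)
Lemma huber_le T s e : 0 <= T ->
  huber T (s + e) <= huber T s + clamp T s * e + e ^+ 2.
Proof.
move=> T0; set l := clamp T (s + e).
have l0T : 0 <= l <= T by rewrite clamp_ge0// clamp_le.
have := huber_max s l0T.
have : (l - clamp T s) * e <= e ^+ 2.
  rewrite (le_trans (ler_norm _))// normrM -[leRHS]ger0_norm ?sqr_ge0// normrX expr2.
  by rewrite ler_wpM2r// /l (le_trans (clamp_lip _ _ T0))// addrAC subrr add0r.
rewrite {2}/huber -/l; lra.
Qed.

Lemma huber_ge0 T s : 0 <= T -> 0 <= huber T s.
Proof.
move=> T0; have := @huber_max T s 0; rewrite lexx T0 => /(_ isT).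
by rewrite mul0r expr0n/= mul0r subr0.
Qed.

Lemma continuous_huber T : continuous (huber T : R -> R^o).
Proof.
have cc : continuous (clamp T : R -> R^o).
  move=> s; apply: (@continuous_min R R (fun s => Num.max s 0 : R^o) (cst (T : R^o))).
    by apply: (@continuous_max R R id (cst (0 : R^o))); [exact: cvg_id|exact: cvg_cst].
  exact: cvg_cst.
move=> s; rewrite /continuous_at /huber; apply: cvgB.
  by apply: cvgM; [exact: cc|exact: cvg_id].
apply: cvgM; last exact: cvg_cst.
by apply: (@cvgM R R _ _ (clamp T) (clamp T)); exact: cc.
Qed.

End Huber.

(** * Minimizing a truncated energy *)

Section ClampedCenter.
Variables (R : realType) (m : nat) (J : finType).
Variables (X : J -> 'rV[R]_m) (g T V : J -> R).

Let slack (c : 'rV[R]_m) j := dot (X j - c) (X j - c) - V j.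
Let psi (c : 'rV[R]_m) : R := \sum_j g j * huber (T j) (slack c j).

Lemma continuous_dot_shift (x : 'rV[R]_m) :
  continuous (fun c : 'rV[R]_m => dot (x - c) (x - c) : R^o).
Proof.
apply: (@continuous_big R^o 'I_m +%R 0 xpredT (@add_continuous R^o)) => i _ c.
have FF : Filter (nbhs c) := nbhs_filter c.
have h : (x - y) ord0 i @[y --> c] --> ((x - c) ord0 i : R^o).
  have -> : (fun y : 'rV[R]_m => (x - y) ord0 i) = (fun y => x ord0 i - y ord0 i).
    by apply/funext => y; rewrite !mxE.
  rewrite !mxE; apply: (@cvgB R R^o _ (nbhs c) FF).
    exact: (@cvg_cst _ _ _ (nbhs c) FF).
  exact: (@coord_continuous R _ _ ord0 i c).
exact: (@cvgM R _ (nbhs c) FF _ _ _ _ h h).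
Qed.

Lemma continuous_huber_energy : continuous (psi : 'rV[R]_m -> R^o).
Proof.
apply: (@continuous_big R^o J +%R 0 xpredT (@add_continuous R^o)) => j _ c.
have FF : Filter (nbhs c) := nbhs_filter c.
apply: (@cvgM R _ (nbhs c) FF); first exact: (@cvg_cst _ _ _ (nbhs c) FF).
apply: (@cvg_comp _ _ _ (slack ^~ j) (huber (T j)) _ (nbhs (slack c j))); last exact: continuous_huber.
apply: (@cvgB R R^o _ (nbhs c) FF); last exact: (@cvg_cst _ _ _ (nbhs c) FF).
exact: continuous_dot_shift.
Qed.

Hypotheses (g_ge0 : forall j, 0 <= g j) (T_ge0 : forall j, 0 <= T j).

(** The term [j0] alone grows at least linearly in the squared distance to [X j0], so that a
    minimizer over a large cube is a global one. *)
Lemma huber_energy_min j0 : 0 < g j0 -> 0 < T j0 ->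
  exists c, forall c', psi c <= psi c'.
Proof.
(* At squared distance [t] from [X j0] the affine lower bound of the term [j0] equals [psi (X j0)].
   As [rad >= 1], a point outside the cube has squared distance at least [rad ^ 2 >= rad >= t]. *)
move=> g0 T0; pose t := psi (X j0) / (g j0 * T j0) + V j0 + T j0 / 2.
pose rad := 1 + `|t|.
have rad0 : 0 <= rad by rewrite addr_ge0.
pose A := [set v : 'rV[R]_m | forall i, `[X j0 ord0 i - rad, X j0 ord0 i + rad]%classic (v ord0 i)].
have cA : compact A.
  apply: (@rV_compact R m (fun i => `[X j0 ord0 i - rad, X j0 ord0 i + rad]%classic)).
  by move=> i; exact: segment_compact.
have A0 : A (X j0) by move=> i /=; rewrite in_itv/= lerBlDr lerDl rad0.
have A0' : A !=set0 by exists (X j0).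
have [c cA' cmin] := EVT_min_rV A0' cA (continuous_subspaceT (A := A) continuous_huber_energy).
exists c => c'; have [c'A|c'A] := pselect (A c'); first by apply: cmin; rewrite inE.
apply: (@le_trans _ _ (psi (X j0))); first by apply: cmin; rewrite inE.
have [i] : exists i, ~ (`[X j0 ord0 i - rad, X j0 ord0 i + rad]%classic (c' ord0 i)).
  by apply/not_existsP => h; apply: c'A => i; apply: contrapT; exact: h.
rewrite /= in_itv/= -ler_distlC => /negP; rewrite -ltNge => out.
have dl : rad <= dot (X j0 - c') (X j0 - c').
  have : ((X j0 - c') ord0 i) ^+ 2 <= dot (X j0 - c') (X j0 - c').
    by rewrite /dot (bigD1 i)//= -expr2 lerDl sumr_ge0// => k _; rewrite -expr2 sqr_ge0.
  apply: le_trans; rewrite !mxE -real_normK ?num_real//.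
  have r1 : 1 <= rad by rewrite lerDl.
  have : rad * rad <= `|X j0 ord0 i - c' ord0 i| * `|X j0 ord0 i - c' ord0 i|.
    by rewrite ler_pM// ltW.
  by rewrite -expr2; apply: le_trans; rewrite ler_peMr.
have : g j0 * huber (T j0) (slack c' j0) <= psi c'.
  rewrite /psi (bigD1 j0)//= lerDl sumr_ge0// => k _.
  by rewrite mulr_ge0// huber_ge0.
apply: le_trans.
have /(_ (slack c' j0)) := @huber_max R (T j0) _ (T j0).
rewrite lexx T_ge0 => /(_ isT) hub.
apply: (@le_trans _ _ (g j0 * (T j0 * slack c' j0 - T j0 ^+ 2 / 2))); last first.
  by rewrite ler_pM2l.
have gT : 0 < g j0 * T j0 by rewrite mulr_gt0.
have -> : psi (X j0) = g j0 * (T j0 * (t - V j0 - T j0 / 2)).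
  by rewrite /t; field; rewrite !gt_eqF.
rewrite ler_pM2l// expr2 -mulrA -mulrBr ler_pM2l//.
have := ler_norm t; rewrite /slack; move: dl; rewrite /rad; lra.
Qed.

(** First-order condition at a minimizer of the energy. The sum [h] is minus half the gradient;
    moving by [t *: h] lowers the energy by [2 * t * dot h h] up to a term of order [t ^ 2], so
    minimality forces [h = 0]. *)
Lemma clamped_center j0 : 0 < g j0 -> 0 < T j0 ->
  exists c, \sum_j (g j * clamp (T j) (dot (X j - c) (X j - c) - V j)) *: (X j - c) = 0.
Proof.
move=> g0 T0; have [c cmin] := huber_energy_min g0 T0.
exists c; set h := \sum_j _; pose l j := g j * clamp (T j) (slack c j).
(* [D t j] is the exact change of the slack of [j] along [t *: h], and [t ^ 2 * C] bounds the sum of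
   the [g j * D t j ^ 2] for [t <= 1]. *)
pose D t j : R := - (2 * t * dot (X j - c) h) + t ^+ 2 * dot h h.
pose C := \sum_j g j * (2 * `|dot (X j - c) h| + dot h h) ^+ 2.
have C0 : 0 <= C by apply: sumr_ge0 => j _; rewrite mulr_ge0// sqr_ge0.
have step t : 0 < t <= 1 -> 2 * dot h h <= t * (C + (\sum_j l j) * dot h h).
  move=> /andP[t0 t1]; have := cmin (c + t *: h); rewrite -subr_ge0 => le0.
  suff : psi (c + t *: h) - psi c <= t * (- (2 * dot h h) + t * (C + (\sum_j l j) * dot h h)).
    by move=> /(le_trans le0); rewrite pmulr_rge0//; lra.
  have sE j : slack (c + t *: h) j = slack c j + D t j.
    rewrite /slack /D opprD addrA; move: (X j - c) => z.
    rewrite !(dotDl, dotDr, dotNl, dotNr, dotZl, dotZr) (dotC h z); ring.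
  rewrite /psi -sumrB.
  apply: (@le_trans _ _ (\sum_j (l j * D t j + g j * D t j ^+ 2))).
    apply: ler_sum => j _; rewrite sE -mulrBr /l -mulrA -mulrDr ler_wpM2l//.
    by have := huber_le (slack c j) (D t j) (T_ge0 j); lra.
  rewrite big_split /=.
  have -> : \sum_j l j * D t j = - (2 * t * dot h h) + t ^+ 2 * ((\sum_j l j) * dot h h).
    have hE : dot h h = \sum_j l j * dot (X j - c) h.
      by rewrite {1}/h dot_suml; apply: eq_bigr => j _; rewrite dotZl.
    rewrite (eq_bigr (fun j => - (2 * t) * (l j * dot (X j - c) h) + t ^+ 2 * dot h h * l j)).
      by rewrite big_split/= -!mulr_sumr -hE; ring.
    by move=> j _; rewrite /D; ring.
  suff : \sum_j g j * D t j ^+ 2 <= t ^+ 2 * C by lra.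
  rewrite /C mulr_sumr; apply: ler_sum => j _; rewrite [leRHS]mulrCA ler_wpM2l//.
  rewrite -exprMn -ler_sqrt ?sqr_ge0// !sqrtr_sqr.
  rewrite [leRHS]ger0_norm; last first.
    by rewrite mulr_ge0 ?addr_ge0 ?dot_ge0 ?mulr_ge0// ltW.
  rewrite /D (le_trans (ler_normD _ _))// mulrDr lerD//.
    by rewrite normrN !normrM (ger0_norm (ltW t0)) (ger0_norm (ler0n _ 2)); lra.
  rewrite ger0_norm; last by rewrite mulr_ge0 ?sqr_ge0 ?dot_ge0.
  by rewrite ler_wpM2r ?dot_ge0// expr2 ler_piMr// ltW.
apply: dot_eq0; apply/eqP; rewrite eq_le dot_ge0 andbT leNgt; apply/negP => hh.
pose Q := C + (\sum_j l j) * dot h h.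
have Q0 : 0 <= Q.
  rewrite addr_ge0// mulr_ge0 ?dot_ge0// sumr_ge0// => j _.
  by rewrite mulr_ge0// clamp_ge0.
(* This [t] makes [t * Q] smaller than [dot h h], against [2 * dot h h <= t * Q]. *)
have := step (Num.min 1 (dot h h / (1 + Q))).
rewrite lt_min ltr01 ge_min lexx divr_gt0//=; last lra.
move=> /(_ isT); rewrite -/Q.
have : Num.min 1 (dot h h / (1 + Q)) * Q <= dot h h / (1 + Q) * Q.
  by rewrite ler_wpM2r// ge_min lexx orbT.
move=> /[swap] /le_trans /[apply].
rewrite mulrAC ler_pdivlMr; last lra.
rewrite mulrC mulrDl; have := mulr_ge0 Q0 (ltW hh); move: hh; set z := dot h h; lra.
Qed.

End ClampedCenter.

(** * A robust extension theorem *)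

Lemma sum_pair_dist (R : realType) (d : nat) (J : finType) (l : J -> R) (P : J -> 'rV[R]_d) :
  \sum_i \sum_j l i * l j * dot (P i - P j) (P i - P j) =
  2 * ((\sum_j l j) * (\sum_j l j * dot (P j) (P j))
       - dot (\sum_j l j *: P j) (\sum_j l j *: P j)).
Proof.
set S := \sum_j l j; set Q := \sum_j l j * dot (P j) (P j); set V := \sum_j l j *: P j.
have Vdot u : \sum_j l j * dot (P j) u = dot V u.
  by rewrite /V dot_suml; apply: eq_bigr => j _; rewrite dotZl.
rewrite (eq_bigr (fun i => l i * dot (P i) (P i) * S + l i * Q - 2 * (l i * dot (P i) V))).
  rewrite sumrB big_split/= -mulr_suml -mulr_suml -mulr_sumr Vdot -/S -/Q; ring.
move=> i _; rewrite (dotC (P i) V) -Vdot [_ * S]mulr_sumr [_ * Q]mulr_sumr.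
have -> : 2 * (l i * \sum_j l j * dot (P j) (P i)) =
    \sum_j 2 * (l i * (l j * dot (P j) (P i))) by rewrite !mulr_sumr.
rewrite -big_split -sumrB /=.
apply: eq_bigr => j _; rewrite !(dotDl, dotDr, dotNl, dotNr) (dotC (P j) (P i)); ring.
Qed.

(* For [e = 0] this is the inequality behind Kirszbraun's theorem. *)
Lemma barycenter_slack (R : realType) (d m : nat) (J : finType) (l : J -> R)
    (X : J -> 'rV[R]_d) (X' : J -> 'rV[R]_m) c c' (L : R) (e : J -> J -> R) :
  (forall j, 0 <= l j) -> \sum_j l j *: (X' j - c') = 0 ->
  (forall i j, dot (X' i - X' j) (X' i - X' j) <=
               L ^+ 2 * dot (X i - X j) (X i - X j) + e i j) ->
  2 * ((\sum_j l j) * \sum_j l j * (dot (X' j - c') (X' j - c')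
                                    - L ^+ 2 * dot (X j - c) (X j - c)))
    <= \sum_i \sum_j l i * l j * e i j.
Proof.
move=> l0 bary h.
have cancel k (Y : J -> 'rV[R]_k) z i j : Y i - z - (Y j - z) = Y i - Y j.
  by rewrite opprB addrA subrK.
have := sum_pair_dist l (fun j => X' j - c'); rewrite bary dot0l subr0 => E'.
have := sum_pair_dist l (fun j => X j - c); set V := \sum_j _ *: _ => E.
have le : \sum_i \sum_j l i * l j * dot (X' i - c' - (X' j - c')) (X' i - c' - (X' j - c'))
   <= L ^+ 2 * (\sum_i \sum_j l i * l j * dot (X i - c - (X j - c)) (X i - c - (X j - c)))
      + \sum_i \sum_j l i * l j * e i j.
  rewrite mulr_sumr -big_split; apply: ler_sum => i _ /=.
  rewrite mulr_sumr -big_split; apply: ler_sum => j _ /=; rewrite !cancel.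
  by have := ler_wpM2l (mulr_ge0 (l0 i) (l0 j)) (h i j); lra.
have -> : \sum_j l j * (dot (X' j - c') (X' j - c') - L ^+ 2 * dot (X j - c) (X j - c)) =
  \sum_j l j * dot (X' j - c') (X' j - c') - L ^+ 2 * \sum_j l j * dot (X j - c) (X j - c).
  by rewrite mulr_sumr -sumrB; apply: eq_bigr => j _; ring.
have := mulr_ge0 (sqr_ge0 L) (dot_ge0 V); move: le; rewrite E' E.
move: (\sum_j l j * dot (X' j - c') (X' j - c')) (\sum_j l j * dot (X j - c) (X j - c)).
move: (\sum_j l j) (\sum_i \sum_j l i * l j * e i j) (L ^+ 2) (dot V V) => a b L2 v x y; lra.
Qed.

Section RobustExtension.
Variables (R : realType) (d m : nat) (I A : finType) (own : I -> A) (a0 : A).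
Variables (X : I -> 'rV[R]_d) (B : A -> 'rV[R]_d).
Variables (X' : I -> 'rV[R]_m) (B' : A -> 'rV[R]_m).
Variables (r a : I -> R) (E : rel I) (tau L1 p zeta : R).
Hypotheses (tau_gt0 : 0 < tau) (tau_le1 : tau <= 1) (L1_ge1 : 1 <= L1) (L1_le2 : L1 + tau <= 2).
Hypotheses (p_ge1 : 1 <= p) (zeta_gt0 : 0 < zeta).
Hypotheses (r_ge0 : forall x, 0 <= r x) (a_ge0 : forall x, 0 <= a x).
Hypothesis lip_BB : forall l l', enorm (B' l - B' l') <= L1 * enorm (B l - B l').
Hypothesis lip_XB : forall x l, enorm (X' x - B' l) <= L1 * enorm (X x - B l).
Hypothesis lip_XX : forall x y, ~~ E x y -> enorm (X' x - X' y) <= L1 * enorm (X x - X y).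
Hypothesis own_X : forall x, enorm (X x - B (own x)) <= 2 * r x.
Hypothesis own_X' : forall x, enorm (X' x - B' (own x)) <= 2 * r x.
Hypothesis sparse : \sum_x \sum_(y | E x y) (a x * r x `^ p) * (a y * r y `^ p) <= zeta ^+ 2.

Let L := L1 + tau.
Let kap := tau ^+ 2 / 4.
Let exc := (18 / tau) ^+ 2.

(** A detour through the anchor of [y] gives [D' <= L1 * D + 6 * r y]. Either the last term is
    absorbed by [tau * D], or [D] is at most [6 * r y / tau], and then [L1 <= 2] yields 18 = 2 * 6 +
    6. *)
Lemma dist_dichotomy x y : enorm (X' x - X' y) <= L * enorm (X x - X y) \/
  enorm (X' x - X' y) <= 18 / tau * r y.
Proof.
set D' := enorm (X' x - X' y); set D := enorm (X x - X y).
have D0 : 0 <= D := enorm_ge0 _.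
have le1 : D' <= L1 * D + 6 * r y.
  apply: le_trans (ler_enormB_trans (B' (own y)) _ _) _.
  apply: (@le_trans _ _ (L1 * (D + 2 * r y) + 2 * r y)).
    apply: lerD; last by rewrite enormBC.
    apply: le_trans (lip_XB _ _) _; rewrite ler_wpM2l//; first by rewrite (le_trans _ L1_ge1).
    by apply: le_trans (ler_enormB_trans (X y) _ _) _; rewrite lerD2l.
  have L12 : L1 <= 2 by move: L1_le2 tau_gt0; lra.
  by have := ler_wpM2r (r_ge0 y) L12; lra.
have [far|near] := leP (6 * r y) (tau * D); first by left; rewrite /L mulrDl; lra.
right; rewrite mulrAC ler_pdivlMr//; apply: le_trans (ler_wpM2r (ltW tau_gt0) le1) _.
have := ler_wpM2r (r_ge0 y) tau_le1.
have := mulr_ge0 (ltW tau_gt0) D0.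
have : 0 <= 2 - L1 by move: L1_le2 tau_gt0; lra.
move: near => /ltW near u /(mulr_ge0 u); lra.
Qed.

(** The dichotomy is used in both orders. If the second alternative holds both times, the squared
    distance is bounded by the product of the two bounds, which is symmetric in [r x] and [r y]. *)
Lemma dist_excess x y : dot (X' x - X' y) (X' x - X' y) <=
  L ^+ 2 * dot (X x - X y) (X x - X y) + (if E x y then exc * (r x * r y) else 0).
Proof.
have L0 : 0 <= L by rewrite addr_ge0// ?(ltW tau_gt0)// (le_trans _ L1_ge1).
have D0 : 0 <= enorm (X x - X y) := enorm_ge0 _.
have D'0 : 0 <= enorm (X' x - X' y) := enorm_ge0 _.
have exc0 : 0 <= exc := sqr_ge0 _.
have good : enorm (X' x - X' y) <= L * enorm (X x - X y) ->
    enorm (X' x - X' y) ^+ 2 <= L ^+ 2 * enorm (X x - X y) ^+ 2.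
  by move=> h; rewrite -exprMn ler_pXn2r// nnegrE mulr_ge0.
rewrite -!sqr_enorm; case: ifPn => [_|/lip_XX h]; last first.
  rewrite addr0; apply: good; apply: le_trans h _.
  by rewrite ler_wpM2r// lerDl ltW.
have [/good h|h] := dist_dichotomy x y.
  by apply: le_trans h _; rewrite lerDl (mulr_ge0 exc0 (mulr_ge0 (r_ge0 x) (r_ge0 y))).
have := dist_dichotomy y x; rewrite (enormBC (X' y)) (enormBC (X y)) => -[/good h'|h'].
  by apply: le_trans h' _; rewrite lerDl (mulr_ge0 exc0 (mulr_ge0 (r_ge0 x) (r_ge0 y))).
apply: (@le_trans _ _ ((18 / tau * r x) * (18 / tau * r y))).
  by rewrite expr2 ler_pM.
have -> : 18 / tau * r x * (18 / tau * r y) = exc * (r x * r y) by rewrite /exc; ring.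
by rewrite lerDr mulr_ge0 ?sqr_ge0.
Qed.

(** The new center minimizes the truncated energy, and [barycenter_slack] bounds its total weighted
    slack by [exc * zeta]. The anchors are so heavy that each must have tiny slack; a point whose
    slack exceeds its truncation level contributes at least [kap ^ 2 * w x * r x ^ p], which limits
    the mass of such points. *)
Lemma clamped_extension (w : I -> R) (c : 'rV[R]_d) (eta : R) :
  (forall x, 0 <= w x <= a x) -> 0 < eta ->
  exists c' : 'rV[R]_m,
    (forall l, enorm (B' l - c') <= L * (enorm (B l - c) + eta)) /\
    kap ^+ 2 * (\sum_(x | (kap * r x) ^+ 2 <
         enorm (X' x - c') ^+ 2 - L ^+ 2 * enorm (X x - c) ^+ 2) w x * r x `^ p)
      <= exc * zeta.
Proof.
move=> w0a eta0.
have w0 x : 0 <= w x by case/andP: (w0a x).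
have wa x : w x <= a x by case/andP: (w0a x).
have L_gt0 : 0 < L by rewrite ltr_wpDl// (le_trans _ L1_ge1).
have exc_gt0 : 0 < exc by rewrite exprn_gt0// divr_gt0.
have kap_gt0 : 0 < kap by rewrite divr_gt0// exprn_gt0.
(* The bound [1 / 2] keeps an anchor below its truncation level 1, so that its clamped slack
   controls its slack. *)
pose eta' := Num.min (2^-1) ((L * eta) ^+ 2).
have eta'_gt0 : 0 < eta' by rewrite lt_min invr_gt0 ltr0n exprn_gt0// mulr_gt0.
(* With this weight a total slack of at most [exc * zeta] forces the clamped slack of an anchor to
   be at most [eta']. *)
pose W := exc * zeta / eta' ^+ 2.
have W_gt0 : 0 < W by rewrite divr_gt0 ?exprn_gt0// mulr_gt0.
(* For a point, [g * T] is [w * r ^ (p - 2)], the largest possible multiplier, and [g * T ^ 2] is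
   [kap ^ 2 * w * r ^ p]. If [r x = 0], the division by zero makes the weight 0. *)
pose g (j : I + A) := if j is inl x then w x * r x `^ p / (kap ^+ 2 * r x ^+ 4) else W.
pose T (j : I + A) := if j is inl x then (kap * r x) ^+ 2 else 1.
pose Y (j : I + A) := match j with inl x => X x | inr l => B l end.
pose Y' (j : I + A) := match j with inl x => X' x | inr l => B' l end.
pose V j := L ^+ 2 * dot (Y j - c) (Y j - c).
have g0 j : 0 <= g j.
  case: j => [x|l] /=; last exact: ltW.
  by rewrite divr_ge0 ?(mulr_ge0 (w0 x) (powR_ge0 _ _))// mulr_ge0 ?sqr_ge0// exprn_ge0.
have T0 j : 0 <= T j by case: j => [x|l] //=; exact: sqr_ge0.
have [c' bary] := @clamped_center R m _ Y' g T V g0 T0 (inr a0) W_gt0 ltr01.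
exists c'; set s := fun j => dot (Y' j - c') (Y' j - c') - V j.
pose lam j := g j * clamp (T j) (s j).
have lam0 j : 0 <= lam j by rewrite mulr_ge0// clamp_ge0.
pose e (i j : I + A) := match i, j with
  | inl x, inl y => if E x y then exc * (r x * r y) else 0 | _, _ => 0 end.
have exc_pair i j : dot (Y' i - Y' j) (Y' i - Y' j) <=
    L ^+ 2 * dot (Y i - Y j) (Y i - Y j) + e i j.
  have weak u v u' v' : enorm (u' - v' : 'rV[R]_m) <= L1 * enorm (u - v : 'rV[R]_d) ->
      dot (u' - v') (u' - v') <= L ^+ 2 * dot (u - v) (u - v) + 0.
    move=> h; have LD0 : 0 <= L * enorm (u - v) by rewrite mulr_ge0 ?enorm_ge0// ltW.
    rewrite addr0 -!sqr_enorm -exprMn ler_pXn2r ?nnegrE ?enorm_ge0//.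
    by apply: le_trans h _; rewrite ler_wpM2r ?enorm_ge0// lerDl ltW.
  case: i j => [x|l] [y|l'] /=; first exact: dist_excess.
  - exact: weak.
  - by apply: weak; rewrite enormBC (enormBC (B l)).
  - exact: weak.
have main := barycenter_slack c lam0 bary exc_pair; rewrite -/s in main.
pose Lam := \sum_j lam j; rewrite -/Lam in main.
have Lam0 : 0 <= Lam by apply: sumr_ge0 => j _.
(* Truncation gives [lam <= a * r ^ (p - 2)]; multiplied out, the bound also covers [r x = 0]. *)
have lamI x : (lam (inl x) * r x) ^+ 2 <= lam (inl x) * (a x * r x `^ p).
  have [r0|rn0] := eqVneq (r x) 0.
    by rewrite r0 mulr0 expr0n /= mulr_ge0// mulr_ge0// powR_ge0.
  have rx : 0 < r x by rewrite lt_neqAle eq_sym rn0 r_ge0.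
  rewrite exprMn expr2 -mulrA ler_wpM2l//.
  have : lam (inl x) <= g (inl x) * T (inl x) by rewrite ler_wpM2l// clamp_le.
  have -> : g (inl x) * T (inl x) = w x * r x `^ p / r x ^+ 2.
    by rewrite /g /T; field; rewrite rn0 gt_eqF.
  rewrite ler_pdivlMr ?exprn_gt0// => /le_trans; apply.
  by rewrite ler_wpM2r// powR_ge0.
have sumE : \sum_i \sum_j lam i * lam j * e i j <= 2 * (Lam * (exc * zeta)).
  have -> : \sum_i \sum_j lam i * lam j * e i j =
      exc * \sum_x \sum_(y | E x y) (lam (inl x) * r x) * (lam (inl y) * r y).
    rewrite big_sumType /= [X in _ + X]big1 ?addr0; last first.
      by move=> l _; apply: big1 => j _; rewrite mulr0.
    rewrite mulr_sumr; apply: eq_bigr => x _.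
    rewrite big_sumType /= [X in _ + X]big1 ?addr0; last by move=> l _; rewrite mulr0.
    rewrite mulr_sumr [RHS]big_mkcond; apply: eq_bigr => y _ /=.
    by case: ifP => _; [ring|rewrite mulr0].
  have -> : 2 * (Lam * (exc * zeta)) = exc * (2 * (Lam * zeta)) by ring.
  rewrite ler_wpM2l ?(ltW exc_gt0)//.
  have [L0|Ln0] := eqVneq Lam 0.
    have lamz j : lam j = 0.
      have /eqP := L0; rewrite psumr_eq0// => /allP /(_ j (mem_index_enum _)).
      by move=> /eqP.
    rewrite big1 ?L0 ?mul0r ?mulr0// => x _; rewrite big1// => y _.
    by rewrite lamz mul0r mul0r.
  have Lp : 0 < Lam by rewrite lt_neqAle eq_sym Ln0.
  pose rho x := a x * r x `^ p.
  have rho0 x : 0 <= rho x by rewrite mulr_ge0// powR_ge0.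
  (* Cauchy-Schwarz in its additive form. The factors [Lam / zeta] and [zeta / Lam] are balanced so
     that each of the two resulting sums is at most [zeta * Lam]. *)
  have amgm x y : (lam (inl x) * r x) * (lam (inl y) * r y) <=
      Lam / zeta * (rho x * rho y) + zeta / Lam * (lam (inl x) * lam (inl y)).
    set P := Lam / zeta * _; set Q := zeta / Lam * _.
    have P0 : 0 <= P := mulr_ge0 (divr_ge0 (ltW Lp) (ltW zeta_gt0)) (mulr_ge0 (rho0 _) (rho0 _)).
    have Q0 : 0 <= Q := mulr_ge0 (divr_ge0 (ltW zeta_gt0) (ltW Lp)) (mulr_ge0 (lam0 _) (lam0 _)).
    have lr0 z : 0 <= lam (inl z) * r z := mulr_ge0 (lam0 _) (r_ge0 z).
    rewrite -(@ler_pXn2r _ 2)// ?nnegrE ?(addr_ge0 P0 Q0) ?(mulr_ge0 (lr0 x) (lr0 y))//.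
    apply: (@le_trans _ _ (P * Q)); last first.
      by rewrite sqrrD; have := sqr_ge0 P; have := sqr_ge0 Q; have := mulr_ge0 P0 Q0; lra.
    have -> : P * Q = lam (inl x) * rho x * (lam (inl y) * rho y).
      by rewrite /P /Q; field; rewrite !gt_eqF.
    by rewrite exprMn ler_pM ?sqr_ge0// lamI.
  pose S := \sum_x lam (inl x).
  have S0 : 0 <= S by apply: sumr_ge0.
  have SL : S <= Lam by rewrite /Lam big_sumType /= lerDl sumr_ge0.
  apply: (@le_trans _ _ (Lam / zeta * zeta ^+ 2 + zeta / Lam * (S * S))).
    apply: (@le_trans _ _ (Lam / zeta * (\sum_x \sum_(y | E x y) rho x * rho y) +
        zeta / Lam * \sum_x \sum_y lam (inl x) * lam (inl y))).
      rewrite !mulr_sumr -big_split; apply: ler_sum => x _ /=.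
      rewrite !mulr_sumr [X in _ + X](bigID (E x))/= addrA -big_split/=.
      rewrite -[leLHS]addr0 lerD//; first by apply: ler_sum => y _; exact: amgm.
      apply: sumr_ge0 => y _.
      exact: mulr_ge0 (divr_ge0 (ltW zeta_gt0) (ltW Lp)) (mulr_ge0 (lam0 _) (lam0 _)).
    apply: lerD; first by rewrite ler_wpM2l// divr_ge0// ltW.
    rewrite ler_wpM2l ?divr_ge0 ?(ltW zeta_gt0)// /S mulr_suml ler_sum// => x _.
    by rewrite mulr_sumr.
  have : S * S <= Lam * Lam by rewrite ler_pM.
  move=> /(ler_wpM2l (divr_ge0 (ltW zeta_gt0) Lam0)).
  have -> : zeta / Lam * (Lam * Lam) = zeta * Lam by field.
  have -> : Lam / zeta * zeta ^+ 2 = zeta * Lam by field; rewrite gt_eqF.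
  lra.
have slack0 j : 0 <= lam j * s j.
  rewrite /lam -mulrA mulr_ge0//.
  exact: le_trans (sqr_ge0 _) (sqr_clamp_le _ (T0 j)).
have total : \sum_j lam j * s j <= exc * zeta.
  have [L0|Ln0] := eqVneq Lam 0.
    have lamz j : lam j = 0.
      have /eqP := L0; rewrite psumr_eq0// => /allP /(_ j (mem_index_enum _)).
      by move=> /eqP.
    by rewrite big1 ?(ltW (mulr_gt0 exc_gt0 zeta_gt0))// => j _; rewrite lamz mul0r.
  have Lp : 0 < Lam by rewrite lt_neqAle eq_sym Ln0.
  by rewrite -(ler_pM2l Lp) -(ler_pM2l (ltr0n R 2)) (le_trans main).
have one j : lam j * s j <= exc * zeta.
  by apply: le_trans total; rewrite (bigD1 j)//= lerDl sumr_ge0.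
split.
  move=> l; have := le_trans (ler_wpM2l (g0 (inr l)) (sqr_clamp_le (s (inr l)) (T0 (inr l)))) _.
  rewrite mulrA => /(_ _ (one (inr l))) /=.
  rewrite /W mulrAC ler_pdivrMr ?exprn_gt0// ler_pM2l ?(mulr_gt0 exc_gt0 zeta_gt0)// => cl.
  have : clamp 1 (s (inr l)) <= eta'.
    by rewrite -(@ler_pXn2r _ 2)// nnegrE ?clamp_ge0// ltW.
  have e2 : eta' <= 2^-1 by rewrite ge_min lexx.
  have e3 : eta' <= (L * eta) ^+ 2 by rewrite ge_min lexx orbT.
  move=> cle; have sle : s (inr l) <= (L * eta) ^+ 2.
    case: (clampP (s (inr l)) ler01) cle => [? ?|? ? ?|? ? ?].
    - by apply: le_trans (sqr_ge0 _).
    - exact: le_trans e3.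
    - by move: e2; lra.
  have n0 := enorm_ge0 (B l - c).
  rewrite -(@ler_pXn2r _ 2)// ?nnegrE ?enorm_ge0//; last first.
    by rewrite mulr_ge0 ?(ltW L_gt0)// addr_ge0// ltW.
  move: sle; rewrite /s /V /= -!sqr_enorm !exprMn.
  have := mulr_ge0 (sqr_ge0 L) (mulr_ge0 n0 (ltW eta0)).
  set L2 := L ^+ 2; set u := enorm _; set v := enorm _; lra.
apply: le_trans total; rewrite big_sumType /= mulr_sumr.
apply: (@le_trans _ _ (\sum_x lam (inl x) * s (inl x))); last first.
  by rewrite lerDl sumr_ge0.
rewrite [leRHS](bigID (fun x => (kap * r x) ^+ 2 < s (inl x)))/= -[leLHS]addr0.
apply: lerD; last by rewrite sumr_ge0.
have sE x : enorm (X' x - c') ^+ 2 - L ^+ 2 * enorm (X x - c) ^+ 2 = s (inl x).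
  by rewrite /s /V /= -!sqr_enorm.
rewrite (eq_bigl (fun x => (kap * r x) ^+ 2 < s (inl x))); last by move=> x; rewrite sE.
apply: ler_sum => x viol.
have [r0|rn0] := eqVneq (r x) 0.
  by rewrite r0 powR0 ?mulr0//; move: p_ge1; lra.
(* The slack exceeds the truncation level, so the multiplier is exactly [g * T] and the contribution
   is at least [g * T ^ 2]. *)
rewrite /lam (@clamp_top _ (T (inl x)) _ (T0 _) (ltW viol)).
apply: (@le_trans _ _ (g (inl x) * T (inl x) * T (inl x))).
  by rewrite le_eqVlt; apply/orP; left; apply/eqP; rewrite /g /T; field; rewrite rn0 gt_eqF.
by rewrite ler_wpM2l ?(mulr_ge0 (g0 _) (T0 _))// ltW.
Qed.

(** A point with slack at most [(kap * r x) ^ 2] satisfies [u <= L * v + kap * r x]. Any other point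
    is reached through its own anchor, at the price [6 * r x], and the mass of these points is
    limited by [clamped_extension]. *)
Lemma robust_extension (w : I -> R) (c : 'rV[R]_d) (e : R) :
  (forall x, 0 <= w x <= a x) -> 0 < e ->
  exists c' : 'rV[R]_m,
    \sum_x w x * enorm (X' x - c') `^ p <=
      ((1 + tau) * (L1 + tau)) `^ p * (\sum_x w x * enorm (X x - c) `^ p)
      + (2 / tau) `^ p * ((tau ^+ 2 / 4) `^ p * (\sum_x w x * r x `^ p)
          + 12 `^ p * ((18 / tau) ^+ 2 / (tau ^+ 2 / 4) ^+ 2 * zeta)) + e.
Proof.
move=> w0a e0; rewrite -/L -/kap -/exc.
have w0 x : 0 <= w x by case/andP: (w0a x).
have p0 : 0 <= p by move: p_ge1; lra.
have L_gt0 : 0 < L by rewrite ltr_wpDl// (le_trans _ L1_ge1).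
have kap_gt0 : 0 < kap by rewrite divr_gt0// exprn_gt0.
(* [eta * K] dominates all the contributions of [eta], which therefore fit into [e]; [eta <= 1] is
   what allows [eta ^ p <= eta]. *)
pose K := (2 / tau) `^ p * 4 `^ p * (1 + \sum_x w x).
have W0 : 0 <= \sum_x w x by apply: sumr_ge0.
have t2 : 0 < 2 / tau by rewrite divr_gt0.
have K0 : 0 < K by rewrite !mulr_gt0 ?powR_gt0//; lra.
pose eta := Num.min 1 (e / K).
have eta0 : 0 < eta by rewrite lt_min ltr01 divr_gt0.
have [c' [anch viol]] := clamped_extension c w0a eta0.
exists c'.
set bad := fun x => (kap * r x) ^+ 2 < enorm (X' x - c') ^+ 2 - L ^+ 2 * enorm (X x - c) ^+ 2.
have pw x : enorm (X' x - c') `^ p <= ((1 + tau) * L) `^ p * enorm (X x - c) `^ p +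
   (2 / tau) `^ p * (kap `^ p * r x `^ p +
      (if bad x then 12 `^ p * r x `^ p else 0) + 4 `^ p * eta).
  set u := enorm (X' x - c'); set v := enorm (X x - c).
  have u0 : 0 <= u := enorm_ge0 _.
  have v0 : 0 <= v := enorm_ge0 _.
  have Lv0 : 0 <= L * v by rewrite mulr_ge0// ltW.
  have tau1 : 0 <= 1 + tau by move: tau_gt0; lra.
  have kr0 : 0 <= kap * r x by rewrite mulr_ge0// ltW.
  have split z : 0 <= z -> u <= L * v + z ->
      u `^ p <= ((1 + tau) * L) `^ p * v `^ p + (2 / tau) `^ p * z `^ p.
    move=> z0 uz; apply: le_trans (ler_powR2l p0 u0 uz) _.
    apply: le_trans (powRD_le p_ge1 tau_gt0 Lv0 z0) _.
    rewrite (powRM _ tau1 (ltW L_gt0)) (powRM _ (ltW L_gt0) v0) mulrA lerD2l.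
    rewrite ler_wpM2r ?powR_ge0//; apply: ler_powR2l => //.
      by rewrite addr_ge0// invr_ge0 ltW.
    by rewrite mulrC -[2]/(1 + 1) mulrDr mulr1 lerD2r invf_ge1.
  have eta4 : 0 <= 4 `^ p * eta by rewrite mulr_ge0 ?powR_ge0// ltW.
  have rp0 : 0 <= kap `^ p * r x `^ p by rewrite mulr_ge0 ?powR_ge0.
  case: ifPn => [_|]; last first.
    rewrite -leNgt => nb.
    have h : u <= L * v + kap * r x.
      rewrite -(@ler_pXn2r _ 2)// ?nnegrE ?addr_ge0//.
      move: nb; rewrite -/u -/v -exprMn.
      by move: (L * v) (kap * r x) Lv0 kr0 => y z y0 z0; have := mulr_ge0 y0 z0; nra.
    apply: le_trans (split _ kr0 h) _; rewrite lerD2l addr0.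
    by rewrite ler_wpM2l ?powR_ge0// (powRM _ (ltW kap_gt0) (r_ge0 x)) lerDl.
  (* Two steps of length [2 * r x] lead to the anchor, one in each space. The one in the source is
     stretched by [L <= 2], whence 6 = 2 + 2 * 2. *)
  have z0 : 0 <= 6 * r x + 2 * eta by have := r_ge0 x; move: eta0; lra.
  have h : u <= L * v + (6 * r x + 2 * eta).
    apply: le_trans (ler_enormB_trans (B' (own x)) _ _) _.
    apply: le_trans (lerD (own_X' x) (anch (own x))) _.
    have h1 : enorm (B (own x) - c) <= 2 * r x + v.
      apply: le_trans (ler_enormB_trans (X x) _ _) _.
      by rewrite lerD2r enormBC.
    have h2 : L * (enorm (B (own x) - c) + eta) <= L * (2 * r x + v + eta).
      by rewrite ler_pM2l// lerD2r.
    have h3 : L * (2 * r x + eta) <= 2 * (2 * r x + eta).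
      by rewrite ler_wpM2r// addr_ge0 ?mulr_ge0// ltW.
    move: h2 h3; lra.
  apply: le_trans (split _ z0 h) _; rewrite lerD2l ler_wpM2l ?powR_ge0//.
  have r60 : 0 <= 6 * r x by rewrite mulr_ge0.
  have e20 : 0 <= 2 * eta by rewrite mulr_ge0// ltW.
  apply: le_trans (powRD_le p_ge1 ltr01 r60 e20) _.
  rewrite invr1 -!powRM//; [|lra..].
  have -> : (1 + 1) * (6 * r x) = 12 * r x by ring.
  have -> : (1 + 1) * (2 * eta) = 4 * eta by ring.
  rewrite (powRM _ _ (r_ge0 x))// (powRM _ _ (ltW eta0))//.
  apply: lerD; first by rewrite lerDr powR_ge0.
  rewrite ler_wpM2l ?powR_ge0// ge1r_powR// eta0 ge_min lexx//.
apply: (@le_trans _ _ (\sum_x (((1 + tau) * L) `^ p * (w x * enorm (X x - c) `^ p) +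
   (2 / tau) `^ p * (kap `^ p * (w x * r x `^ p) +
      12 `^ p * (if bad x then w x * r x `^ p else 0)) + (2 / tau) `^ p * 4 `^ p * eta * w x))).
  apply: ler_sum => x _; apply: le_trans (ler_wpM2l (w0 x) (pw x)) _.
  by rewrite le_eqVlt; apply/orP; left; apply/eqP; case: ifP => _; ring.
rewrite !big_split/= -!mulr_sumr big_split/= -!mulr_sumr; apply: lerD.
  rewrite lerD2l ler_wpM2l ?powR_ge0// lerD2l ler_wpM2l ?powR_ge0//.
  rewrite -big_mkcond mulrAC ler_pdivlMr ?exprn_gt0// mulrC; exact: viol.
apply: (@le_trans _ _ (eta * K)).
  rewrite [_ * eta]mulrC -[leLHS]mulrA ler_wpM2l ?(ltW eta0)// /K.
  by rewrite [leRHS]mulrDr mulr1 lerDr mulr_ge0 ?powR_ge0.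
apply: (@le_trans _ _ (e / K * K)); first by rewrite ler_wpM2r ?(ltW K0)// ge_min lexx orbT.
by rewrite divfK// gt_eqF.
Qed.

End RobustExtension.

(** * Transfer of clustering costs *)

Section Value.
Variables (R : realType) (I J : finType) (p : R).
Hypothesis p_ge1 : 1 <= p.

Definition value (d : nat) (w : J -> I -> R) (f : I -> 'rV[R]_d) (c : J -> 'rV[R]_d) : R :=
  \sum_j \sum_x w j x * enorm (f x - c j) `^ p.

Lemma value_ge0 d w (f : I -> 'rV[R]_d) c : (forall j x, 0 <= w j x) -> 0 <= value w f c.
Proof.
by move=> w0; apply: sumr_ge0 => j _; apply: sumr_ge0 => x _; rewrite mulr_ge0// powR_ge0.
Qed.

Definition is_split (a : I -> R) (w : J -> I -> R) : Prop :=
  (forall j x, 0 <= w j x) /\ (forall x, \sum_j w j x = a x).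

Lemma is_split_le a w j x : is_split a w -> 0 <= w j x <= a x.
Proof.
by move=> [w0 wa]; rewrite w0 -wa (bigD1 j)//= lerDl sumr_ge0.
Qed.

Lemma sum_split a w (F : I -> R) : is_split a w ->
  \sum_j \sum_x w j x * F x = \sum_x a x * F x.
Proof.
move=> [w0 wa]; rewrite exchange_big/=; apply: eq_bigr => x _.
by rewrite -mulr_suml wa.
Qed.

Lemma inv1D_le (t : R) : 0 < t <= 1 -> 1 + t^-1 <= 2 / t.
Proof.
move=> /andP[t0 t1]; rewrite mulrC -[2]/(1 + 1) mulrDr mulr1 lerD2r.
by rewrite invf_ge1.
Qed.

(** The weights of a point over all clusters add up to [a x], so the price of moving the points is
    the same for every solution and every choice of centers. *)
Lemma value_move d a w (f f' : I -> 'rV[R]_d) c (t : R) : is_split a w -> 0 < t <= 1 ->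
  value w f c <= (1 + t) `^ p * value w f' c
                 + (2 / t) `^ p * \sum_x a x * enorm (f x - f' x) `^ p.
Proof.
move=> aw /andP[t0 t1]; have w0 := aw.1.
have p0 : 0 <= p by move: p_ge1; lra.
rewrite -(sum_split (fun x => enorm (f x - f' x) `^ p) aw) /value !mulr_sumr -big_split/=.
apply: ler_sum => j _; rewrite !mulr_sumr -big_split/=; apply: ler_sum => x _.
rewrite mulrCA [_ `^ p * (w j x * _)]mulrCA -mulrDr ler_wpM2l//.
have h : enorm (f x - c j) <= enorm (f' x - c j) + enorm (f x - f' x).
  by rewrite [leRHS]addrC; exact: ler_enormB_trans.
apply: le_trans (ler_powR2l p0 (enorm_ge0 _) h) _.
apply: le_trans (powRD_le p_ge1 t0 (enorm_ge0 _) (enorm_ge0 _)) _.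
rewrite lerD2l ler_wpM2r ?powR_ge0//; apply: ler_powR2l => //.
  by rewrite addr_ge0// invr_ge0 ltW.
by rewrite inv1D_le// t0.
Qed.

End Value.

Section Transfer.
Variables (R : realType) (I J A : finType) (own : I -> A) (a0 : A) (b : A -> I).
Variables (a r : I -> R) (good : pred I) (E : rel I) (tau p : R).
Hypotheses (tau_gt0 : 0 < tau) (tau_le : tau <= 8^-1) (p_ge1 : 1 <= p).
Hypotheses (r_ge0 : forall x, 0 <= r x) (a_ge0 : forall x, 0 <= a x).

Definition stray (d : nat) (f : I -> 'rV[R]_d) : R :=
  \sum_(x | ~~ good x) a x * enorm (f x - f (b (own x))) `^ p.

(** Formulated for two arbitrary maps so that it serves the passage to the projected points and the
    passage back; [1 + 2 * tau] dominates both [1 + tau] and [(1 - tau)^-1] for [tau <= 1 / 2]. *)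
Definition near_lipschitz (d m : nat) (f : I -> 'rV[R]_d) (f' : I -> 'rV[R]_m) : Prop :=
  let lip x y := enorm (f' x - f' y) <= (1 + 2 * tau) * enorm (f x - f y) in
  [/\ forall l l', lip (b l) (b l'),
      forall x l, good x -> lip x (b l),
      forall x y, good x -> good y -> ~~ E x y -> lip x y
    & forall x, good x -> enorm (f x - f (b (own x))) <= 2 * r x].

Lemma value_transfer (d m : nat) (f : I -> 'rV[R]_d) (f' : I -> 'rV[R]_m) (zeta : R)
    (w : J -> I -> R) (c : J -> 'rV[R]_d) (e : R) :
  near_lipschitz f f' -> (forall x, good x -> enorm (f' x - f' (b (own x))) <= 2 * r x) ->
  0 < zeta ->
  \sum_x \sum_(y | E x y) (a x * r x `^ p) * (a y * r y `^ p) <= zeta ^+ 2 ->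
  is_split a w -> 0 < e ->
  exists c' : J -> 'rV[R]_m,
    value p w f' c' <=
      (1 + tau) `^ p * (((1 + tau) * (1 + 3 * tau)) `^ p *
           ((1 + tau) `^ p * value p w f c + (2 / tau) `^ p * stray f)
        + (2 / tau) `^ p * ((tau ^+ 2 / 4) `^ p * (\sum_x a x * r x `^ p)
          + #|J|%:R * (12 `^ p * ((18 / tau) ^+ 2 / (tau ^+ 2 / 4) ^+ 2 * zeta))) + #|J|%:R * e)
      + (2 / tau) `^ p * stray f'.
Proof.
move=> [lipBB lipXB lipXX ownX] ownX' zeta0 sparse aw e0.
(* Points that are not good are replaced by their anchors in both spaces. A pair containing one
   inherits an estimate for anchors, so only pairs of good points can remain distorted. *)
pose X x := if good x then f x else f (b (own x)).
pose X' x := if good x then f' x else f' (b (own x)).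
pose E' x y := [&& good x, good y & E x y].
have tau1 : tau <= 1 by move: tau_le; lra.
have t01 : 0 < tau <= 1 by rewrite tau_gt0.
have L1_ge1 : 1 <= 1 + 2 * tau by move: tau_gt0; lra.
have L1_le2 : 1 + 2 * tau + tau <= 2 by move: tau_le; lra.
have lip_XB x l : enorm (X' x - f' (b l)) <= (1 + 2 * tau) * enorm (X x - f (b l)).
  by rewrite /X' /X; case: ifP => gx; [exact: lipXB|exact: lipBB].
have lip_XX x y : ~~ E' x y -> enorm (X' x - X' y) <= (1 + 2 * tau) * enorm (X x - X y).
  rewrite /E' /X /X'; case gx : (good x); case gy : (good y); move=> /= nE.
  - exact: lipXX.
  - exact: lipXB.
  - by rewrite enormBC (enormBC (f (b _))); exact: lipXB.
  - exact: lipBB.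
have own_X x : enorm (X x - f (b (own x))) <= 2 * r x.
  by rewrite /X; case: ifP => [/ownX//|_]; rewrite subrr enorm0 mulr_ge0.
have own_X' x : enorm (X' x - f' (b (own x))) <= 2 * r x.
  by rewrite /X'; case: ifP => [/ownX'//|_]; rewrite subrr enorm0 mulr_ge0.
have sparse' : \sum_x \sum_(y | E' x y) (a x * r x `^ p) * (a y * r y `^ p) <= zeta ^+ 2.
  apply: le_trans sparse; apply: ler_sum => x _; rewrite big_mkcond [leRHS]big_mkcond.
  apply: ler_sum => y _; rewrite /E'; have := mulr_ge0 (a_ge0 x) (powR_ge0 (r x) p).
  have := mulr_ge0 (a_ge0 y) (powR_ge0 (r y) p) => h1 h2.
  by case: (good x); case: (good y) => //=; case: ifP => // _; rewrite mulr_ge0.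
(* Each cluster is extended separately. The terms in [w] add up to terms in [a], whereas the term in
   [zeta] is paid once per cluster; this is the origin of the factor [#|J|]. *)
have ext j := robust_extension (I := I) (B := f \o b) (B' := f' \o b) a0 tau_gt0 tau1 L1_ge1 L1_le2
  p_ge1 zeta0 r_ge0 a_ge0 (fun l l' => lipBB l l') lip_XB lip_XX own_X own_X' sparse' (c j)
  (fun x => is_split_le j x aw) e0.
have [c' c'P] := choice ext.
have strayE k (g : I -> 'rV[R]_k) (G : I -> 'rV[R]_k) :
    (forall x, G x = if good x then g x else g (b (own x))) ->
    \sum_x a x * enorm (g x - G x) `^ p = stray g.
  move=> GE; rewrite /stray [RHS]big_mkcond; apply: eq_bigr => x _; rewrite GE.
  case: ifP => //= _; rewrite subrr enorm0 powR0 ?mulr0//.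
  by move: p_ge1; lra.
exists c'; apply: le_trans (value_move p_ge1 f' X' c' aw t01) _.
rewrite (strayE _ f' X')// lerD2r ler_wpM2l ?powR_ge0//.
apply: (@le_trans _ _ (\sum_j (((1 + tau) * (1 + 2 * tau + tau)) `^ p * (\sum_x w j x * enorm (X x - c j) `^ p)
      + (2 / tau) `^ p * ((tau ^+ 2 / 4) `^ p * (\sum_x w j x * r x `^ p)
          + 12 `^ p * ((18 / tau) ^+ 2 / (tau ^+ 2 / 4) ^+ 2 * zeta)) + e))).
  by apply: ler_sum => j _; exact: c'P.
rewrite !big_split/= -!mulr_sumr big_split/= -!mulr_sumr (sum_split _ aw).
rewrite !sumr_const -[e *+ _]mulr_natl -[zeta *+ _]mulr_natl.
rewrite [_ * (_ * zeta)]mulrCA [12 `^ p * (#|_|%:R * _)]mulrCA lerD2r lerD2r.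
have -> : 1 + 2 * tau + tau = 1 + 3 * tau by ring.
rewrite ler_wpM2l ?powR_ge0//.
apply: le_trans (value_move p_ge1 X f c aw t01) _.
have -> // : \sum_x a x * enorm (X x - f x) `^ p = stray f.
rewrite -(strayE _ f X (fun x => erefl)); apply: eq_bigr => x _.
by congr (_ * _ `^ p); exact: enormBC.
Qed.

End Transfer.

Lemma expR_le_1D2 (R : realType) (x : R) : 0 <= x -> x <= 2^-1 -> expR x <= 1 + 2 * x.
Proof.
move=> x0 x1; have h := expR_ge1Dx (- x); rewrite expRN in h.
have e0 := expR_gt0 x.
have : (1 - x) * expR x <= 1 by rewrite -ler_pdivlMr// mul1r.
have h2 : 0 <= (1 - 2 * x) * x by rewrite mulr_ge0//; lra.
have h3 : 0 < 1 - x by lra.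
move=> h4; rewrite -(ler_pM2l h3); apply: le_trans h4 _; lra.
Qed.

Lemma powR_1D_le (R : realType) (t p : R) : 0 <= t -> 0 <= p -> (1 + t) `^ p <= expR (t * p).
Proof.
move=> t0 p0; rewrite expRM; apply: ler_powR2l => //; first lra.
exact: expR_ge1Dx.
Qed.

(* The number of clusters is [N]; the constant [72] is [18 * 4], and [48] absorbs the
   factors [2], [12] and [2] of the three uses of the convexity inequality. *)
Definition sparsity (R : realType) (tau p : R) (N : nat) : R :=
  tau ^+ 7 / (72 ^+ 2 * N%:R) * (tau / 48) `^ p.

Section Distortion.
Variables (R : realType) (I J A : finType) (own : I -> A) (a0 : A) (b : A -> I).
Variables (a r : I -> R) (good : pred I) (E : rel I) (eps p tau : R).
Hypotheses (tau_gt0 : 0 < tau) (tp : tau * p = eps / 100) (eps01 : 0 < eps < 1) (p_ge1 : 1 <= p) (J_gt0 : (0 < #|J|)%N).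
Hypotheses (r_ge0 : forall x, 0 <= r x) (a_ge0 : forall x, 0 <= a x).

Let opt := \sum_x a x * r x `^ p.
Let theta := sparsity tau p #|J|.

(** Calibration of [value_transfer]. Since [tau * p = eps / 100], the powers of [1 + tau] stay close
    to 1, and [sparsity] is chosen so that every error is at most a few times
    [tau * 2^-1 ^ p * opt]: seven of these in all, which [eps / 8] absorbs. *)
Lemma value_distortion (d m : nat) (f : I -> 'rV[R]_d) (f' : I -> 'rV[R]_m)
    (w : J -> I -> R) (c : J -> 'rV[R]_d) (e : R) :
  near_lipschitz own b r good E tau f f' ->
  (forall x, good x -> enorm (f' x - f' (b (own x))) <= 2 * r x) ->
  stray own b a good p f <= theta * opt -> stray own b a good p f' <= theta * opt ->
  \sum_x \sum_(y | E x y) (a x * r x `^ p) * (a y * r y `^ p) <= (theta * opt) ^+ 2 ->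
  is_split a w -> 0 < e ->
  exists c' : J -> 'rV[R]_m,
    value p w f' c' <= (1 + eps / 8) * value p w f c + eps / 8 * (2^-1 `^ p * opt) + e.
Proof.
move=> lip own' sf sf' sparse aw e0.
case/andP: eps01 => eps0 eps1; have t_gt0 := tau_gt0.
have p_gt0 : 0 < p by move: p_ge1; lra.
have tau_le : tau <= eps / 100 by rewrite -tp ler_peMr// ltW.
have tau8 : tau <= 8^-1 by lra.
have opt0 : 0 <= opt by apply: sumr_ge0 => x _; rewrite mulr_ge0// powR_ge0.
have N0 : 0 < #|J|%:R :> R by rewrite ltr0n.
have N1 : 1 <= #|J|%:R :> R by rewrite ler1n.
have c0 : 0 < 72 ^+ 2 * #|J|%:R :> R by rewrite mulr_gt0// exprn_gt0.
have th0 : 0 <= theta.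
  exact: mulr_ge0 (divr_ge0 (exprn_ge0 _ (ltW tau_gt0)) (ltW c0)) (powR_ge0 _ _).
pose T := (2 / tau) `^ p; pose h : R := 2^-1 `^ p.
pose C := 12 `^ p * ((18 / tau) ^+ 2 / (tau ^+ 2 / 4) ^+ 2).
have T0 : 0 <= T := powR_ge0 _ _.
have h0 : 0 <= h := powR_ge0 _ _.
have C0 : 0 <= C by rewrite mulr_ge0 ?powR_ge0// divr_ge0// sqr_ge0.
have TNC0 : 0 <= T * #|J|%:R * C := mulr_ge0 (mulr_ge0 T0 (ltW N0)) C0.
(* [opt] may be 0 while [value_transfer] needs a positive [zeta], so [e2] is added to [theta * opt].
   The contributions of [e1] and [e2] are at most [e / 4] each before the outer factor [A1 <= 2]. *)
pose e1 := e / (4 * (1 + #|J|%:R)).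
pose e2 := e / (4 * (1 + T * #|J|%:R * C)).
have e10 : 0 < e1 by rewrite divr_gt0// mulr_gt0//; lra.
have e20 : 0 < e2 by rewrite divr_gt0// mulr_gt0//; lra.
have z0 : 0 < theta * opt + e2 by rewrite ltr_wpDl// (mulr_ge0 th0 opt0).
have sparse' : \sum_x \sum_(y | E x y) (a x * r x `^ p) * (a y * r y `^ p)
    <= (theta * opt + e2) ^+ 2.
  apply: le_trans sparse _; rewrite ler_pXn2r ?nnegrE ?(mulr_ge0 th0 opt0) ?(ltW z0)//.
  by rewrite lerDl ltW.
have [c' c'P] := value_transfer a0 tau_gt0 tau8 p_ge1 r_ge0 a_ge0 c lip own' z0 sparse' aw e10.
exists c'; apply: le_trans c'P _.
rewrite -/opt -/T.
set v := value _ _ _ _; set s := stray _ _ _ _ _ _ in sf *; set s' := stray _ _ _ _ _ _ in sf' *.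
have v0 : 0 <= v by apply: value_ge0 => j x; exact: aw.1.
pose A1 := (1 + tau) `^ p; pose A2 := ((1 + tau) * (1 + 3 * tau)) `^ p; rewrite -/A1 -/A2.
have A10 : 0 <= A1 := powR_ge0 _ _.
have A20 : 0 <= A2 := powR_ge0 _ _.
have A1le : A1 <= expR (eps / 100).
  by rewrite -tp; apply: powR_1D_le; exact: ltW.
have A2le : A2 <= expR (eps / 100) * expR (3 * (eps / 100)).
  rewrite /A2 powRM; [|lra..]; apply: ler_pM; rewrite ?powR_ge0//.
  by rewrite -tp mulrA; apply: powR_1D_le; [exact: mulr_ge0 (ler0n _ _) (ltW tau_gt0)|exact: ltW].
have m1 : A1 * (A2 * A1) <= 1 + eps / 8.
  apply: (@le_trans _ _ (expR (eps / 100) * (expR (eps / 100) * expR (3 * (eps / 100)) * expR (eps / 100)))).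
    by rewrite ler_pM ?mulr_ge0// ler_pM.
  rewrite -!expRD; apply: le_trans (expR_le_1D2 _ _) _; lra.
have m2 : A1 * A2 <= 2.
  apply: (@le_trans _ _ (expR (eps / 100) * (expR (eps / 100) * expR (3 * (eps / 100))))).
    by rewrite ler_pM.
  rewrite -!expRD; apply: le_trans (expR_le_1D2 _ _) _; lra.
have m3 : A1 <= 2 by apply: le_trans A1le _; apply: le_trans (expR_le_1D2 _ _) _; lra.
have Tth : T * theta <= tau * h.
  have -> : T * theta = tau ^+ 7 / (72 ^+ 2 * #|J|%:R) * 24^-1 `^ p.
    rewrite /theta /sparsity mulrCA; congr (_ * _).
    rewrite /T -powRM ?divr_ge0 ?(ltW tau_gt0)//.
    by congr (_ `^ p); field; rewrite gt_eqF.
  apply: ler_pM; rewrite ?powR_ge0//.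
  - exact: divr_ge0 (exprn_ge0 _ (ltW tau_gt0)) (ltW c0).
  - rewrite ler_pdivrMr// exprS ler_pM2l//.
    have : tau ^+ 6 <= 1 by rewrite exprn_ile1 ?ltW//; lra.
    move: N1; lra.
  - by apply: ler_powR2l => //; lra.
have Tkap : T * (tau ^+ 2 / 4) `^ p <= tau * h.
  have -> : T * (tau ^+ 2 / 4) `^ p = tau `^ p * h.
    rewrite /T /h -!powRM ?divr_ge0 ?sqr_ge0 ?(ltW tau_gt0)//.
    by congr (_ `^ p); field; rewrite gt_eqF.
  by rewrite ler_wpM2r// ge1r_powR// tau_gt0; lra.
have TC : T * (#|J|%:R * (C * theta)) = tau * h.
  have -> : C = 72 ^+ 2 / tau ^+ 6 * 12 `^ p by rewrite /C; field; rewrite gt_eqF.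
  have -> : h = T * 12 `^ p * (tau / 48) `^ p.
    rewrite /T /h -!powRM ?mulr_ge0 ?invr_ge0 ?(ltW tau_gt0)//.
    by congr (_ `^ p); field; rewrite gt_eqF.
  rewrite /theta /sparsity /T; move: ((2 / tau) `^ p) (12 `^ p) ((tau / 48) `^ p) => u y z.
  by field; rewrite !gt_eqF.
have Ts : T * s <= tau * h * opt.
  by apply: le_trans (ler_wpM2l T0 sf) _; rewrite mulrA ler_wpM2r.
have Ts' : T * s' <= tau * h * opt.
  by apply: le_trans (ler_wpM2l T0 sf') _; rewrite mulrA ler_wpM2r.
have Tk : T * ((tau ^+ 2 / 4) `^ p * opt) <= tau * h * opt by rewrite mulrA ler_wpM2r.
have err2 : T * #|J|%:R * C * e2 <= e / 4.
  have -> : T * #|J|%:R * C * e2 = (T * #|J|%:R * C) / (1 + T * #|J|%:R * C) * (e / 4).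
    by rewrite /e2; field; rewrite gt_eqF//; move: TNC0; lra.
  rewrite ler_piMl ?ler_pdivrMr ?mul1r//; move: TNC0 e0; lra.
have err1 : #|J|%:R * e1 <= e / 4.
  have -> : #|J|%:R * e1 = #|J|%:R / (1 + #|J|%:R) * (e / 4).
    by rewrite /e1; field; rewrite gt_eqF//; move: N0; lra.
  rewrite ler_piMl ?ler_pdivrMr ?mul1r//; move: N0 e0; lra.
have Tz : T * (#|J|%:R * (12 `^ p * ((18 / tau) ^+ 2 / (tau ^+ 2 / 4) ^+ 2 * (theta * opt + e2))))
   <= tau * h * opt + e / 4.
  rewrite [12 `^ p * _]mulrA -/C.
  have -> : T * (#|J|%:R * (C * (theta * opt + e2))) =
     T * (#|J|%:R * (C * theta)) * opt + T * #|J|%:R * C * e2 by ring.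
  by rewrite TC lerD2l.
set Z := T * (#|J|%:R * _) in Tz.
have -> : A1 * (A2 * (A1 * v + T * s) + T * ((tau ^+ 2 / 4) `^ p * opt
       + #|J|%:R * (12 `^ p * ((18 / tau) ^+ 2 / (tau ^+ 2 / 4) ^+ 2 * (theta * opt + e2)))) + #|J|%:R * e1)
    + T * s' = A1 * (A2 * A1) * v + A1 * A2 * (T * s)
    + A1 * (T * ((tau ^+ 2 / 4) `^ p * opt) + Z + #|J|%:R * e1) + T * s' by rewrite /Z; ring.
have q0 : 0 <= tau * h * opt := mulr_ge0 (mulr_ge0 (ltW tau_gt0) h0) opt0.
have t1 : A1 * (A2 * A1) * v <= (1 + eps / 8) * v by rewrite ler_wpM2r.
have t2 : A1 * A2 * (T * s) <= 2 * (tau * h * opt).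
  apply: le_trans (ler_wpM2l (mulr_ge0 A10 A20) Ts) _.
  by rewrite ler_wpM2r.
have t3 : A1 * (T * ((tau ^+ 2 / 4) `^ p * opt) + Z + #|J|%:R * e1)
    <= 2 * (2 * (tau * h * opt) + e / 2).
  have le : T * ((tau ^+ 2 / 4) `^ p * opt) + Z + #|J|%:R * e1 <= 2 * (tau * h * opt) + e / 2 by lra.
  apply: le_trans (ler_wpM2l A10 le) _; rewrite ler_wpM2r//; move: q0 e0; lra.
have t4 : 7 * (tau * h * opt) <= eps / 8 * (h * opt).
  have : 0 <= h * opt := mulr_ge0 h0 opt0.
  by rewrite -mulrA mulrA => ho; rewrite ler_wpM2r//; lra.
rewrite -/h; move: t1 t2 t3 t4 Ts'; lra.
Qed.

End Distortion.

(** * Markov bounds and measurability *)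

Section Markov.
Context (disp : measure_display) (T : measurableType disp) (R : realType).
Variables (P : probability T R) (I : finType).
Variables (A : nat -> I -> set T) (alpha : nat -> I -> R) (beta : nat -> R).

(** Markov's inequality for the series of all weighted indicators, whose expectation is at most
    [delta]; [G] is the event that the series is below 1. Summing over [s] first makes one event
    serve all the partial sums. *)
Lemma markov_weighted_indicators (delta : R) :
  (forall s i, measurable (A s i)) -> (forall s i, 0 <= alpha s i) ->
  (forall s i, (P (A s i) <= (beta s)%:E)%E) ->
  (forall N, \sum_(0 <= s < N) \sum_i alpha s i * beta s <= delta) ->
  exists G, [/\ measurable G, ((1 - delta)%:E <= P G)%E &
    forall t, G t -> forall N, \sum_(0 <= s < N) \sum_i alpha s i * \1_(A s i) t < 1].
Proof.
move=> mA a0 Pb sumb.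
pose f1 s i : T -> \bar R := fun t => (alpha s i * \1_(A s i) t)%:E.
pose f s : T -> \bar R := fun t => (\sum_i f1 s i t)%E.
have mf1 s i : measurable_fun setT (f1 s i).
  by apply/measurable_EFinP; apply: measurable_funM => //; exact: measurable_indic.
have f10 s i t : (0 <= f1 s i t)%E by rewrite lee_fin mulr_ge0.
have mf s : measurable_fun setT (f s) by apply: emeasurable_sum => i; exact: mf1.
have f0 s t : (0 <= f s t)%E by apply: sume_ge0 => i _; exact: f10.
pose Q t := (\sum_(s <oo) f s t)%E.
have Q0 t : (0 <= Q t)%E by apply: nneseries_ge0 => s _ _; exact: f0.
have mQ : measurable_fun setT Q by apply: ge0_emeasurable_sum => [s t _ _|s _]; [exact: f0|exact: mf].
have intf s : (\int[P]_t f s t <= (\sum_i alpha s i * beta s)%:E)%E.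
  rewrite ge0_integral_sum//= -sumEFin; apply: lee_sum => i _.
  rewrite (@integralZl_indic _ _ _ _ _ _ (fun=> A s i))//; last first.
    by move=> h; have := a0 s i; rewrite leNgt h.
  rewrite integral_indic// setIT EFinM.
  by apply: lee_wpmul2l; [rewrite lee_fin|exact: Pb].
have intQ : (\int[P]_t Q t <= delta%:E)%E.
  rewrite integral_nneseries//; apply: lime_le.
    by apply: is_cvg_nneseries => s _ _; apply: integral_ge0.
  near=> N; apply: le_trans (lee_sum _ (fun s _ => intf s)) _.
  by rewrite sumEFin lee_fin.
pose G := [set t | (Q t < 1%:E)%E].
have mG : measurable G by rewrite -[G]setTI; exact: emeasurable_fun_infty_o.
exists G; split => //.
  have := @le_integral_comp_abse _ T R P setT measurableT Q 1 id (@measurable_id _ _ _) (fun r h => h)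
    (fun x y _ _ h => h) mQ ltr01.
  rewrite setTI mul1e.
  under eq_integral do rewrite gee0_abs//.
  move=> /le_trans /(_ intQ) h.
  have GE : ~` G = [set t | (1%:E <= `|Q t|)%E].
    apply/seteqP; split => t /=; rewrite /G /= gee0_abs//.
      by move=> /negP; rewrite -leNgt.
    by move=> h1; apply/negP; rewrite -leNgt.
  rewrite -GE in h.
  have -> : P G = (1 - P (~` G))%E.
    by rewrite -[in LHS](setCK G) probability_setC//; exact: measurableC.
  by rewrite EFinB leeB.
move=> t Gt N; rewrite -lte_fin; apply: le_lt_trans Gt.
rewrite -sumEFin; under eq_bigr do rewrite -sumEFin.
by apply: nneseries_lim_ge => s _ _; exact: f0.
Unshelve. all: by end_near. Qed.

End Markov.

Section MatrixMeasurability.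
Context (disp : measure_display) (T : measurableType disp) (R : realType) (d m : nat).
Variable M : T -> 'M[R]_(d, m).
Hypothesis mM : forall i j, measurable_fun [set: T] (fun t => M t i j).

(** An open set of matrices is a countable union of rational boxes, and the preimage of a box is cut
    out by finitely many measurable entries. *)
Lemma measurable_open_preimage (U : set 'M[R]_(d, m)) :
  (forall B, U B -> exists2 e, 0 < e &
     forall B' : 'M[R]_(d, m), (forall i j, `|B' i j - B i j| < e) -> U B') ->
  measurable [set t | U (M t)].
Proof.
move=> openU.
pose box (q : 'M[rat]_(d, m)) (e : rat) :=
  [set B : 'M[R]_(d, m) | forall i j, `|B i j - ratr (q i j)| < ratr e].
(* Boxes not contained in [U] are sent to the empty set, so that the union runs over a whole
   countable type. *)
pose F (qe : 'M[rat]_(d, m) * rat) : set T :=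
  if `[< box qe.1 qe.2 `<=` U >] then [set t | box qe.1 qe.2 (M t)] else set0.
have -> : [set t | U (M t)] = \bigcup_qe F qe.
  apply/seteqP; split => [t /= /openU[e e0 h]|t [qe _]]; last first.
    by rewrite /F; case: asboolP => // sub /= h; exact: sub.
  have /rat_in_itvoo[e' ] : 0 < e / 2 by rewrite divr_gt0.
  rewrite in_itv/= => /andP[e'0 e'e].
  have approx (ij : 'I_d * 'I_m) : exists q : rat, `|M t ij.1 ij.2 - ratr q| < ratr e'.
    have /rat_in_itvoo[q] : M t ij.1 ij.2 - ratr e' < M t ij.1 ij.2 + ratr e'.
      by rewrite ltrD2l gtrN.
    by rewrite in_itv/= -ltr_distlC => ?; exists q.
  have [q qP] := choice approx.
  exists (\matrix_(i, j) q (i, j), e') => //; rewrite /F; case: asboolP => /= [_ i j|[]].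
    by rewrite mxE; exact: (qP (i, j)).
  move=> B hB; apply: h => i j; have := hB i j; rewrite mxE => h1.
  rewrite -(subrK (ratr (q (i, j))) (B i j)) -addrA (le_lt_trans (ler_normD _ _))//.
  have := qP (i, j); rewrite /= distrC => h2; move: h1 h2 e'e.
  by move: (`|B i j - _|) (`|_ - M t i j|) => u v; lra.
apply: countable_bigcupT_measurable => // -[q e]; rewrite /F; case: asboolP => // _ /=.
have -> : [set t | box q e (M t)] =
    \bigcap_(ij in [set: 'I_d * 'I_m]) [set t | `|M t ij.1 ij.2 - ratr (q ij.1 ij.2)| < ratr e].
  by apply/seteqP; split => t /= h; [move=> ij _; exact: h|move=> i j; exact: (h (i, j))].
apply: fin_bigcap_measurable => // ij _.
have mh : measurable_fun setT (fun t => `|M t ij.1 ij.2 - ratr (q ij.1 ij.2)|).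
  by apply: measurableT_comp => //; apply: measurable_funB.
have -> : [set t | `|M t ij.1 ij.2 - ratr (q ij.1 ij.2)| < ratr e] =
    setT `&` (fun t => `|M t ij.1 ij.2 - ratr (q ij.1 ij.2)|) @^-1` `]-oo, (ratr e)[.
  by rewrite setTI; apply/seteqP; split => t /=; rewrite in_itv.
by apply: mh => //; exact: measurable_itv.
Qed.

End MatrixMeasurability.

Section MatrixContinuity.
Variables (R : realType) (d m : nat).

Lemma enorm_le_sum (y : 'rV[R]_m) : enorm y <= \sum_j `|y ord0 j|.
Proof.
rewrite -(@ler_pXn2r _ 2)// ?nnegrE ?enorm_ge0 ?sumr_ge0//.
rewrite sqr_enorm /dot expr2 mulr_suml; apply: ler_sum => j _.
rewrite -expr2 -real_normK ?num_real// expr2 ler_wpM2l//.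
by rewrite (bigD1 j)//= lerDl sumr_ge0.
Qed.

(** The difference is linear in [B' - B], so one radius works for all [B]. *)
Lemma enorm_mul_cont (x : 'rV[R]_d) (e : R) : 0 < e -> exists2 r, 0 < r &
  forall B B' : 'M[R]_(d, m), (forall i j, `|B' i j - B i j| < r) ->
    enorm (x *m B' - x *m B) < e.
Proof.
move=> e0; pose K := 1 + m%:R * \sum_i `|x ord0 i|.
have K0 : 0 < K by rewrite ltr_pwDl// mulr_ge0// sumr_ge0.
exists (e / K) => [|B B' h]; first by rewrite divr_gt0.
apply: le_lt_trans (enorm_le_sum _) _.
apply: (@le_lt_trans _ _ (\sum_(j < m) (\sum_i `|x ord0 i|) * (e / K))).
  apply: ler_sum => j _; rewrite -mulmxBr mxE (le_trans (ler_norm_sum _ _ _))//.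
  rewrite mulr_suml; apply: ler_sum => i _; rewrite normrM ler_wpM2l//.
  by have := h i j; rewrite !mxE => /ltW.
rewrite sumr_const card_ord -mulrnAl -[_ *+ m]mulr_natl mulrCA gtr_pMr//.
by rewrite ltr_pdivrMr// mul1r /K ltrDr.
Qed.

End MatrixContinuity.

(** * The good event *)

Lemma probability_setI_ge (disp : measure_display) (T : measurableType disp) (R : realType)
    (P : probability T R) (G H : set T) (x y : R) :
  measurable G -> measurable H -> ((1 - x)%:E <= P G)%E -> ((1 - y)%:E <= P H)%E ->
  ((1 - (x + y))%:E <= P (G `&` H))%E.
Proof.
move=> mG mH.
have C K : measurable K -> P K = (1 - P (~` K))%E.
  by move=> mK; rewrite -[in LHS](setCK K) probability_setC//; exact: measurableC.
have fC K : measurable K -> P (~` K) \is a fin_num.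
  by move=> mK; apply: fin_num_measure; exact: measurableC.
rewrite (C _ mG) (C _ mH) (C _ (measurableI _ _ mG mH)) setCI.
have mU : measurable (~` G `|` ~` H) by apply: measurableU; exact: measurableC.
have fU : P (~` G `|` ~` H) \is a fin_num by exact: fin_num_measure.
have : fine (P (~` G `|` ~` H)) <= fine (P (~` G)) + fine (P (~` H)).
  rewrite -lee_fin EFinD !fineK ?fC//.
  by apply: measureU2; exact: measurableC.
rewrite -(fineK fU) -(fineK (fC _ mG)) -(fineK (fC _ mH)) /=.
by rewrite -!EFinD !lee_fin; lra.
Qed.

Lemma markov_weighted_finite (disp : measure_display) (T : measurableType disp) (R : realType)
    (P : probability T R) (I : finType) (A : I -> set T) (alpha : I -> R) (beta delta : R) :
  (forall i, measurable (A i)) -> (forall i, 0 <= alpha i) ->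
  (forall i, (P (A i) <= beta%:E)%E) -> 0 <= delta -> (\sum_i alpha i) * beta <= delta ->
  exists G, [/\ measurable G, ((1 - delta)%:E <= P G)%E &
    forall t, G t -> \sum_i alpha i * \1_(A i) t < 1].
Proof.
move=> mA a0 Pb d0 sumb.
have [||||G [mG PG hG]] := @markov_weighted_indicators _ T R P I (fun=> A)
    (fun s i => if s == 0%N then alpha i else 0) (fun=> beta) delta.
- by [].
- by move=> s i; case: ifP.
- by [].
- case=> [|N]; first by rewrite big_geq.
  rewrite big_nat_recl// [X in _ + X]big1 ?addr0 -?mulr_suml//.
  by move=> s _; rewrite big1// => i _; rewrite mul0r.
by exists G; split => // t /hG /(_ 1%N); rewrite big_nat1.
Qed.

(** Undoes the normalization of the Markov weights. For [opt = 0] the quotients are 0 and carry no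
    information, but then all masses vanish. *)
Lemma sum_normalized_le (R : realType) (I : finType) (W e : I -> R) (opt theta : R) :
  0 < theta -> 0 <= opt -> (opt = 0 -> forall i, W i = 0) ->
  \sum_i W i / (theta * opt) * e i < 1 -> \sum_i W i * e i <= theta * opt.
Proof.
move=> th0; rewrite le_eqVlt => /orP[/eqP<- /(_ erefl) W0 _|o0 _ h].
  by rewrite mulr0 big1// => i _; rewrite W0 mul0r.
have to : 0 < theta * opt by rewrite mulr_gt0.
rewrite -[leRHS]mul1r -ler_pdivrMr//; apply/ltW; apply: le_lt_trans h.
rewrite mulr_suml; apply: ler_sum => i _.
by rewrite mulrAC.
Qed.

Section GoodMatrix.
Variables (R : realType) (d m : nat) (I A : finType) (pts : I -> 'rV[R]_d).
Variables (b : A -> I) (own : I -> A) (a : I -> R) (tau theta p : R).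
Implicit Types B : 'M[R]_(d, m).

Definition distorted (t : R) (x : 'rV[R]_d) B : bool :=
  t * enorm x < `|enorm (x *m B) - enorm x|.

Definition anchor_dist x := enorm (pts x - pts (b (own x))).
Definition anchor_cost := \sum_x a x * anchor_dist x `^ p.
Definition good_point B x := [forall l, ~~ distorted tau (pts x - pts (b l)) B].
Definition bad_edge B x y := distorted tau (pts x - pts y) B.

(** No clause mentions the weights of a solution: one good matrix handles all solutions at once. *)
Definition good_matrix B : Prop :=
  [/\ forall l l', ~~ bad_edge B (b l) (b l'),
      stray own b a (good_point B) p pts <= theta * anchor_cost,
      stray own b a (good_point B) p (fun x => pts x *m B) <= theta * anchor_cost
    & \sum_x \sum_(y | bad_edge B x y) (a x * anchor_dist x `^ p) * (a y * anchor_dist y `^ p)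
        <= (theta * anchor_cost) ^+ 2].

Hypotheses (a_ge0 : forall x, 0 <= a x) (p_ge1 : 1 <= p) (theta_gt0 : 0 < theta).

Lemma anchor_dist_ge0 x : 0 <= anchor_dist x. Proof. exact: enorm_ge0. Qed.

Lemma mass_ge0 x : 0 <= a x * anchor_dist x `^ p. Proof. by rewrite mulr_ge0// powR_ge0. Qed.

Lemma anchor_cost_ge0 : 0 <= anchor_cost. Proof. by apply: sumr_ge0 => x _; exact: mass_ge0. Qed.

Lemma anchor_cost_eq0 : anchor_cost = 0 -> forall x, a x * anchor_dist x `^ p = 0.
Proof.
move=> /eqP; rewrite psumr_eq0; last by move=> x _; exact: mass_ge0.
by move=> /allP h x; apply/eqP; apply: h; exact: mem_index_enum.
Qed.

(* Splits the range of the stretch factor, so that each piece has its own tail bound. *)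
Lemma stretched_distorted B x : exists s : nat,
  (2 * anchor_dist x < enorm ((pts x - pts (b (own x))) *m B)) ->
  distorted s.+1%:R (pts x - pts (b (own x))) B /\
  enorm ((pts x - pts (b (own x))) *m B) <= s.+3%:R * anchor_dist x.
Proof.
set z := pts x - _; set y := enorm (z *m B); rewrite /anchor_dist -/z; set r := enorm z.
have r0 : 0 <= r := enorm_ge0 _.
have [far|] := ltP (2 * r) y; last by exists 0%N.
have [r0'|rn0] := eqVneq r 0.
  have z0 : z = 0 by apply: dot_eq0; rewrite -sqr_enorm -/r r0' expr0n.
  by move: far; rewrite /y z0 mul0mx enorm0 r0' mulr0 ltxx.
have rp : 0 < r by rewrite lt_neqAle eq_sym rn0.
have ex : exists s, y <= s.+3%:R * r.
  have := archi_boundP (ltW (divr_gt0 (le_lt_trans (mulr_ge0 (ler0n _ 2) r0) far) rp)).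
  rewrite ltr_pdivrMr// => h; exists (Num.bound (y / r)); apply: le_trans (ltW h) _.
  by rewrite ler_wpM2r// ler_nat -addn3 leq_addr.
(* Minimality of [s] gives [(s + 2) * r < y], hence a distortion above [(s + 1) * r]; for [s = 0]
   this is the hypothesis [far]. *)
have := ex_minnP ex; case=> s ys smin; exists s => _; split => //.
rewrite /distorted -/r -/y; apply: lt_le_trans (ler_norm _).
rewrite ltrBrDr -[X in _ + X]mul1r -mulrDl natr1.
case: s ys smin => [//|s] ys smin; rewrite ltNge; apply/negP => h.
by have := smin s h; rewrite ltnn.
Qed.

(** A bad point whose image lies within [2 * anchor_dist x] of that of its anchor is charged to the
    second sum, any other to the piece [s x] of the third. The factors 2 in these sums give each
    case half of the budget. *)
Lemma good_matrixP B :
  (\sum_(ll : A * A) (distorted tau (pts (b ll.1) - pts (b ll.2)) B)%:R < 1 :> R) ->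
  \sum_(xl : I * A) (2 * 2 `^ p * (a xl.1 * anchor_dist xl.1 `^ p)) *
     (distorted tau (pts xl.1 - pts (b xl.2)) B)%:R <= theta * anchor_cost ->
  (forall N : nat, \sum_(0 <= s < N) \sum_x (2 * s.+3%:R `^ p * (a x * anchor_dist x `^ p)) *
     (distorted s.+1%:R (pts x - pts (b (own x))) B)%:R <= theta * anchor_cost) ->
  \sum_(xy : I * I) ((a xy.1 * anchor_dist xy.1 `^ p) * (a xy.2 * anchor_dist xy.2 `^ p)) *
     (distorted tau (pts xy.1 - pts xy.2) B)%:R <= (theta * anchor_cost) ^+ 2 ->
  good_matrix B.
Proof.
move=> h1 h2 h3 h4.
have p0 : 0 <= p by move: p_ge1; lra.
have near : 2 * 2 `^ p * (\sum_(x | ~~ good_point B x) a x * anchor_dist x `^ p) <= theta * anchor_cost.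
  apply: le_trans h2; rewrite -(pair_bigA _ (fun x l => 2 * 2 `^ p * (a x * anchor_dist x `^ p) *
    (distorted tau (pts x - pts (b l)) B)%:R))/= mulr_sumr big_mkcond.
  apply: ler_sum => x _; have W0 : 0 <= 2 * 2 `^ p * (a x * anchor_dist x `^ p).
    by rewrite mulr_ge0 ?mass_ge0// mulr_ge0 ?powR_ge0.
  case: ifPn => [|_]; last by apply: sumr_ge0 => l _; rewrite mulr_ge0.
  rewrite negb_forall => /existsP[l]; rewrite negbK => dl.
  rewrite (bigD1 l)//= dl mulr1 lerDl sumr_ge0// => k _.
  by rewrite mulr_ge0.
have V0 : 0 <= \sum_(x | ~~ good_point B x) a x * anchor_dist x `^ p.
  by apply: sumr_ge0 => x _; exact: mass_ge0.
have p2 : 1 <= 2 `^ p :> R by apply: le_trans (le1r_powR _ p_ge1); rewrite ler1n.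
split.
- move=> l l'; apply/negP => dl; move: h1; rewrite ltNge => /negP; apply.
  by rewrite (bigD1 (l, l'))//= -/(bad_edge B (b l) (b l')) dl lerDl sumr_ge0.
- rewrite /stray; apply: le_trans near; rewrite -[leLHS]mul1r ler_wpM2r//.
  by move: p2; lra.
- rewrite /stray.
  apply: (@le_trans _ _ (2 `^ p * (\sum_(x | ~~ good_point B x) a x * anchor_dist x `^ p) + theta * anchor_cost / 2)); last first.
    by move: near; rewrite -mulrA; lra.
  have [s sP] := choice (stretched_distorted B).
  (* A single partial sum that reaches the index [s x] of every point. *)
  pose N := (\max_x s x).+1.
  apply: (@le_trans _ _ (2 `^ p * (\sum_(x | ~~ good_point B x) a x * anchor_dist x `^ p) +
     \sum_x \sum_(0 <= k < N) k.+3%:R `^ p * (a x * anchor_dist x `^ p) *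
     (distorted k.+1%:R (pts x - pts (b (own x))) B)%:R)); last first.
    rewrite lerD2l ler_pdivlMr// mulrC exchange_big/= mulr_sumr.
    apply: le_trans (h3 N); apply: ler_sum => k _; rewrite mulr_sumr.
    by apply: ler_sum => x _; rewrite !mulrA.
  rewrite mulr_sumr big_mkcond [X in _ <= X + _]big_mkcond -big_split/=.
  apply: ler_sum => x _.
  have T0 k : 0 <= k.+3%:R `^ p * (a x * anchor_dist x `^ p) *
     (distorted k.+1%:R (pts x - pts (b (own x))) B)%:R.
    by rewrite !mulr_ge0 ?powR_ge0.
  have S0 : 0 <= \sum_(0 <= k < N) k.+3%:R `^ p * (a x * anchor_dist x `^ p) *
     (distorted k.+1%:R (pts x - pts (b (own x))) B)%:R by apply: sumr_ge0.
  case: ifP => _; last by rewrite add0r.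
  rewrite -mulmxBl; set y := enorm _.
  have [yr|yr] := leP y (2 * anchor_dist x).
    apply: (@le_trans _ _ (2 `^ p * (a x * anchor_dist x `^ p))); last by rewrite lerDl.
    rewrite mulrCA ler_wpM2l// -powRM ?anchor_dist_ge0//.
    by apply: ler_powR2l => //; exact: enorm_ge0.
  have [ds ys] := sP x yr.
  apply: (@le_trans _ _ (\sum_(0 <= k < N) k.+3%:R `^ p * (a x * anchor_dist x `^ p) *
     (distorted k.+1%:R (pts x - pts (b (own x))) B)%:R)); last first.
    by rewrite lerDr mulr_ge0 ?powR_ge0 ?mass_ge0.
  rewrite (@big_cat_nat _ _ _ (s x).+1)//=; last by rewrite ltnS leq_bigmax.
  rewrite big_nat_recr//= ds mulr1 addrAC -[leLHS]add0r lerD ?addr_ge0 ?sumr_ge0//.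
  rewrite mulrCA ler_wpM2l// -powRM ?anchor_dist_ge0//.
  by apply: ler_powR2l => //; exact: enorm_ge0.
- apply: le_trans h4; rewrite -(pair_bigA _ (fun x y => (a x * anchor_dist x `^ p) * (a y * anchor_dist y `^ p) *
    (distorted tau (pts x - pts y) B)%:R))/=.
  apply: ler_sum => x _; rewrite big_mkcond; apply: ler_sum => y _.
  by rewrite /bad_edge; case: ifP => _; rewrite ?mulr1 ?mulr0.
Qed.

End GoodMatrix.

Section GoodEvent.
Context (disp : measure_display) (T : measurableType disp) (R : realType).
Variables (P : probability T R) (d m : nat) (M : T -> 'M[R]_(d, m)) (c0 : R).
Hypothesis JL : is_JL_map c0 P M.
Variables (I A : finType) (pts : I -> 'rV[R]_d).
Variables (b : A -> I) (own : I -> A) (a : I -> R) (tau theta p delta : R).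
Hypotheses (a_ge0 : forall x, 0 <= a x) (p_ge1 : 1 <= p) (theta_gt0 : 0 < theta).
Hypotheses (tau_gt0 : 0 < tau) (delta_gt0 : 0 < delta).

(** Distortion is a strict inequality between continuous functions of the matrix, hence an open
    condition. *)
Lemma measurable_distorted (t : R) (x : 'rV[R]_d) :
  measurable [set w | distorted t x (M w)].
Proof.
apply: (measurable_open_preimage JL.1 (U := [set B | distorted t x B])) => B /= dB.
have [|r r0 h] := @enorm_mul_cont R d m x (`|enorm (x *m B) - enorm x| - t * enorm x).
  by rewrite subr_gt0.
exists r => // B' /h; rewrite /distorted => close.
have := ler_enormD (x *m B' - x *m B) (x *m B); rewrite subrK => h1.
have := ler_enormD (x *m B - x *m B') (x *m B'); rewrite subrK enormBC => h2.
have h3 : `|enorm (x *m B) - enorm x| <=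
    `|enorm (x *m B') - enorm x| + enorm (x *m B' - x *m B).
  rewrite -(subrK (enorm (x *m B')) (enorm (x *m B))) -addrA addrC.
  apply: le_trans (ler_normD _ _) _; rewrite lerD2l ler_norml; lra.
by move: close; lra.
Qed.

Lemma prob_distorted (t : R) (x : 'rV[R]_d) : 0 < t ->
  (P [set w | distorted t x (M w)] <= (2 * expR (- (c0 * t ^+ 2 * m%:R)))%:E)%E.
Proof. by move=> t0; exact: JL.2. Qed.

Lemma indic_bool (Q : T -> bool) t : \1_[set w | Q w] t = (Q t)%:R :> R.
Proof.
rewrite indicE; congr (_%:R); congr nat_of_bool.
by apply/idP/idP; rewrite inE.
Qed.

Let mass x := a x * anchor_dist pts b own x `^ p.
Let beta := 2 * expR (- (c0 * tau ^+ 2 * m%:R)).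

(** The total Markov weight is bounded whatever the number of points, which is why that number does
    not enter the dimension. *)
Lemma mass_normalized : \sum_x mass x / (theta * anchor_cost pts b own a p) <= theta^-1.
Proof.
rewrite -mulr_suml -[\sum_x _]/(anchor_cost pts b own a p) invfM mulrCA.
have o0 : 0 <= anchor_cost pts b own a p by exact: anchor_cost_ge0.
by rewrite ler_piMr ?invr_ge0 ?(ltW theta_gt0)//; have [->|oz] := eqVneq (anchor_cost pts b own a p) 0;
  rewrite ?mul0r// mulfV.
Qed.

(** Four families of distortion events, each given a quarter of [delta]: pairs of anchors, pairs of
    a point and an anchor, large stretches of points from their own anchors, and pairs of points
    weighted by the product measure. *)
Lemma good_event :
  (#|A| * #|A|)%:R * beta <= delta / 4 ->
  2 * 2 `^ p * #|A|%:R / theta * beta <= delta / 4 ->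
  (forall N : nat, \sum_(0 <= s < N) 2 * s.+3%:R `^ p / theta *
     (2 * expR (- (c0 * s.+1%:R ^+ 2 * m%:R))) <= delta / 4) ->
  theta ^- 2 * beta <= delta / 4 ->
  exists G, [/\ measurable G, ((1 - delta)%:E <= P G)%E &
    forall t, G t -> good_matrix pts b own a tau theta p (M t)].
Proof.
move=> n1 n2 n3 n4.
have d4 : 0 <= delta / 4 by rewrite divr_ge0// ltW.
have beta0 : 0 <= beta by rewrite mulr_ge0// expR_ge0.
have o0 : 0 <= anchor_cost pts b own a p by exact: anchor_cost_ge0.
have mass0 x : 0 <= mass x by exact: mass_ge0.
have to0 : 0 <= theta * anchor_cost pts b own a p by rewrite mulr_ge0// ltW.
have [|||||G1 [mG1 PG1 hG1]] := @markov_weighted_finite _ T R P (A * A)%type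
    (fun ll => [set w | distorted tau (pts (b ll.1) - pts (b ll.2)) (M w)])
    (fun=> 1) beta (delta / 4).
- by move=> ?; exact: measurable_distorted.
- by [].
- by move=> ?; exact: prob_distorted.
- by [].
- by rewrite sumr_const card_prod.
have [|||||G2 [mG2 PG2 hG2]] := @markov_weighted_finite _ T R P (I * A)%type
    (fun xl => [set w | distorted tau (pts xl.1 - pts (b xl.2)) (M w)])
    (fun xl => 2 * 2 `^ p * mass xl.1 / (theta * anchor_cost pts b own a p)) beta (delta / 4).
- by move=> ?; exact: measurable_distorted.
- by move=> xl; rewrite divr_ge0// mulr_ge0// mulr_ge0// powR_ge0.
- by move=> ?; exact: prob_distorted.
- by [].
- apply: le_trans n2; rewrite ler_wpM2r//.
  rewrite -(pair_bigA _ (fun x (l : A) => 2 * 2 `^ p * mass x / (theta * anchor_cost pts b own a p)))/=.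
  under eq_bigr do rewrite sumr_const -[_ *+ #|_|]mulr_natr.
  rewrite -mulr_suml; under eq_bigr do rewrite -mulrA.
  rewrite -mulr_sumr mulrAC ler_wpM2l ?mass_normalized//.
have [||||G3 [mG3 PG3 hG3]] := @markov_weighted_indicators _ T R P I
    (fun s x => [set w | distorted s.+1%:R (pts x - pts (b (own x))) (M w)])
    (fun s x => 2 * s.+3%:R `^ p * mass x / (theta * anchor_cost pts b own a p))
    (fun s => 2 * expR (- (c0 * s.+1%:R ^+ 2 * m%:R))) (delta / 4).
- by move=> ? ?; exact: measurable_distorted.
- by move=> s x; rewrite divr_ge0// mulr_ge0// mulr_ge0// powR_ge0.
- by move=> s x; apply: prob_distorted; rewrite ltr0n.
- move=> N; apply: le_trans (n3 N); apply: ler_sum => s _.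
  rewrite -mulr_suml ler_wpM2r ?mulr_ge0 ?expR_ge0//.
  under eq_bigr do rewrite -mulrA.
  rewrite -mulr_sumr ler_wpM2l ?mass_normalized//.
have [|||||G4 [mG4 PG4 hG4]] := @markov_weighted_finite _ T R P (I * I)%type
    (fun xy => [set w | distorted tau (pts xy.1 - pts xy.2) (M w)])
    (fun xy => mass xy.1 * mass xy.2 / (theta ^+ 2 * (anchor_cost pts b own a p) ^+ 2)) beta (delta / 4).
- by move=> ?; exact: measurable_distorted.
- by move=> xy; exact: divr_ge0 (mulr_ge0 (mass0 _) (mass0 _)) (mulr_ge0 (sqr_ge0 _) (sqr_ge0 _)).
- by move=> ?; exact: prob_distorted.
- by [].
- apply: le_trans n4; rewrite ler_wpM2r//.
  rewrite -(pair_bigA _ (fun x y => mass x * mass y / (theta ^+ 2 * anchor_cost pts b own a p ^+ 2)))/=.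
  have -> : \sum_x \sum_y mass x * mass y / (theta ^+ 2 * anchor_cost pts b own a p ^+ 2) =
     (\sum_x mass x / (theta * anchor_cost pts b own a p)) ^+ 2.
    rewrite [RHS]expr2 mulr_suml; apply: eq_bigr => x _; rewrite mulr_sumr; apply: eq_bigr => y _.
    by rewrite -exprMn expr2 invfM mulrACA.
  rewrite -exprVn ler_pXn2r ?nnegrE ?invr_ge0 ?(ltW theta_gt0) ?mass_normalized//.
  by apply: sumr_ge0 => x _; rewrite divr_ge0.
exists (G1 `&` G2 `&` (G3 `&` G4)); split.
- by apply: measurableI; exact: measurableI.
- have -> : delta = delta / 4 + delta / 4 + (delta / 4 + delta / 4) by field.
  by apply: probability_setI_ge; [exact: measurableI..|exact: probability_setI_ge|exact: probability_setI_ge].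
move=> t [[/hG1 h1 /hG2 h2] [/hG3 h3 /hG4 h4]].
have om : anchor_cost pts b own a p = 0 -> forall x, mass x = 0 by exact: anchor_cost_eq0.
apply: good_matrixP => //.
- by move: h1; under eq_bigr do rewrite mul1r indic_bool.
- apply: (sum_normalized_le theta_gt0 o0); first by move=> /om h xl; rewrite /= -/(mass _) h mulr0.
  by move: h2; under eq_bigr do rewrite indic_bool.
- move=> N; have [oz|on0] := eqVneq (anchor_cost pts b own a p) 0.
    rewrite oz mulr0 big1// => s _; rewrite big1// => x _.
    by rewrite -/(mass x) (om oz) mulr0 mul0r.
  have topos : 0 < theta * anchor_cost pts b own a p by rewrite mulr_gt0// lt_neqAle eq_sym on0.
  rewrite -[leRHS]mul1r -ler_pdivrMr//; apply/ltW; apply: le_lt_trans (h3 N).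
  rewrite mulr_suml; apply: ler_sum => s _; rewrite mulr_suml; apply: ler_sum => x _.
  by rewrite indic_bool mulrAC.
- rewrite exprMn; apply: sum_normalized_le; rewrite ?exprn_gt0 ?sqr_ge0//.
    by move=> /eqP; rewrite sqrf_eq0 => /eqP /om h xy; rewrite -/(mass _) -/(mass _) h mul0r.
  by move: h4; under eq_bigr do rewrite indic_bool.
Qed.

End GoodEvent.

(** * The choice of the constants *)

Section Constants.
Variable R : realType.

Lemma pow2_le_expR (k : nat) : 2 ^+ k <= expR k%:R :> R.
Proof.
rewrite -[k%:R]mulr1 mulrC expRM_natr lerXn2r ?nnegrE ?expR_ge0//.
by have := expR_ge1Dx (1 : R).
Qed.

Lemma nat_le_expR (j k : nat) : (j <= 2 ^ k)%N -> j%:R <= expR k%:R :> R.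
Proof.
by move=> h; apply: le_trans (pow2_le_expR k); rewrite -natrX ler_nat.
Qed.

Lemma le_expR (x : R) : x <= expR x.
Proof. by apply: le_trans (expR_ge1Dx x); rewrite lerDr. Qed.

Lemma sum_half_pow_le1 (N : nat) : \sum_(0 <= s < N) 2^-1 ^+ s.+1 <= 1 :> R.
Proof.
suff -> : \sum_(0 <= s < N) 2^-1 ^+ s.+1 = 1 - 2^-1 ^+ N :> R by rewrite gerBl exprn_ge0.
elim: N => [|N IH]; first by rewrite big_geq// expr0 subrr.
by rewrite big_nat_recr//= IH exprS; field.
Qed.

Variables (n m : nat) (c0 eps delta p : R).
Hypotheses (c0_gt0 : 0 < c0) (n_gt0 : (0 < n)%N) (eps01 : 0 < eps < 1) (delta01 : 0 < delta < 1).
Hypothesis p_ge1 : 1 <= p.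
Let lam := Num.max 1 (ln (n%:R / (eps * delta))).
Hypothesis m_large : 3 * 10 ^+ 6 / c0 * (p ^+ 4 / eps ^+ 2 * lam) <= m%:R.

Let X := p ^+ 2 * lam.
Let tau := eps / (100 * p).
Let theta := sparsity tau p n.

Lemma log_factor_ge1 : 1 <= lam. Proof. by rewrite le_max lexx. Qed.

Lemma parameters_expR : [/\ n%:R <= expR lam, expR (- lam) <= eps & expR (- lam) <= delta].
Proof.
case/andP: eps01 => e0 e1; case/andP: delta01 => d0 d1.
have n1 : 1 <= n%:R :> R by rewrite ler1n.
have ed0 : 0 < eps * delta by rewrite mulr_gt0.
have q0 : 0 < n%:R / (eps * delta) by rewrite divr_gt0// ltr0n.
have : n%:R / (eps * delta) <= expR lam.
  by rewrite -[leLHS]lnK ?posrE// ler_expR le_max lexx orbT.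
rewrite ler_pdivrMr// => h; have E0 := expR_gt0 lam.
have bound x : 0 < x -> eps * delta <= x -> expR (- lam) <= x.
  move=> x0 hx; rewrite expRN -[leLHS]mul1r ler_pdivrMr//.
  apply: le_trans n1 _; apply: le_trans h _; rewrite mulrC ler_wpM2r//; exact: ltW.
split.
- apply: le_trans h _; rewrite ler_piMr ?(ltW E0)//.
  by rewrite mulr_ile1// ltW.
- by apply: bound => //; rewrite ler_piMr// ltW.
- by apply: bound => //; rewrite ler_piMl// ltW.
Qed.

Lemma scaled_eps_expR : expR (- (9 * (p * lam))) <= tau.
Proof.
have [_ he _] := parameters_expR; have l1 := log_factor_ge1; have p1 := p_ge1.
have p_gt0 : 0 < p by lra.
have pl : p <= p * lam by rewrite ler_peMr// ltW.
have lp : lam <= p * lam by rewrite ler_peMl//; lra.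
rewrite /tau ler_pdivlMr ?mulr_gt0//.
apply: (@le_trans _ _ (expR (- (9 * (p * lam))) * (expR 7%:R * expR p))).
  rewrite ler_wpM2l ?expR_ge0// ler_pM//; [exact: ltW|exact: nat_le_expR|exact: le_expR].
rewrite -!expRD; apply: le_trans he; rewrite ler_expR.
by move: pl lp l1; lra.
Qed.

Lemma scaled_eps_gt0 : 0 < tau.
Proof. exact: lt_le_trans (expR_gt0 _) scaled_eps_expR. Qed.

(** The exponents add up as 93 = 63 + 14 + 1 + 15, for [tau ^ 7], [72 ^ 2], [n] and
    [(tau / 48) ^ p]. The last one raises [expR (- (15 * (p * lam)))] to the power [p] and is the
    source of [p ^ 2] in [X]. *)
Lemma sparsity_expR : expR (- (93 * X)) <= theta.
Proof.
have [hn _ _] := parameters_expR; have l1 := log_factor_ge1; have p1 := p_ge1.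
have p_gt0 : 0 < p by lra.
have l0 : 0 < lam by lra.
have n0 : 0 < n%:R :> R by rewrite ltr0n.
have plX : p * lam <= X by rewrite /X ler_pM2r// expr2 ler_peMl// ltW.
have lp : lam <= p * lam by rewrite ler_peMl//; lra.
have t7 : expR (- (63 * (p * lam))) <= tau ^+ 7.
  apply: le_trans (_ : expR (- (9 * (p * lam))) ^+ 7 <= _).
    by rewrite -expRM_natr ler_expR; lra.
  by rewrite lerXn2r ?nnegrE ?expR_ge0 ?(ltW scaled_eps_gt0)// scaled_eps_expR.
have t48 : expR (- (15 * (p * lam))) <= tau / 48.
  rewrite ler_pdivlMr//; apply: le_trans scaled_eps_expR.
  apply: (@le_trans _ _ (expR (- (15 * (p * lam))) * expR 6%:R)).
    by rewrite ler_wpM2l ?expR_ge0//; exact: (@nat_le_expR 48 6).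
  rewrite -expRD ler_expR; lra.
have t48p : expR (- (15 * X)) <= (tau / 48) `^ p.
  have -> : - (15 * X) = - (15 * (p * lam)) * p by rewrite /X; ring.
  by rewrite expRM; apply: ler_powR2l; rewrite ?expR_ge0 ?(ltW p_gt0).
have c72 : 72 ^+ 2 * n%:R <= expR (14%:R + lam).
  rewrite expRD; apply: ler_pM => //.
  have -> : 14%:R = 7%:R * 2%:R :> R by rewrite -natrM.
  by rewrite expRM_natr lerXn2r ?nnegrE ?expR_ge0//; exact: (@nat_le_expR 72 7).
rewrite /theta /sparsity.
apply: (@le_trans _ _ (expR (- (63 * (p * lam))) / expR (14%:R + lam) * expR (- (15 * X)))).
  by rewrite -expRB -expRD ler_expR; lra.
apply: ler_pM; rewrite ?divr_ge0 ?expR_ge0//.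
apply: ler_pM; rewrite ?invr_ge0 ?expR_ge0//.
by rewrite lef_pV2 ?posrE ?expR_gt0// mulr_gt0// exprn_gt0.
Qed.

Lemma sparsity_gt0 : 0 < theta.
Proof. exact: lt_le_trans (expR_gt0 _) sparsity_expR. Qed.

Lemma exponent_ge1 : 1 <= X.
Proof.
rewrite /X -[leLHS]mulr1 ler_pM ?log_factor_ge1// expr2 -[leLHS]mulr1.
by rewrite ler_pM ?p_ge1.
Qed.

(** The constant [3 * 10 ^ 6] is 300 times the [100 ^ 2] in [tau ^ 2]. The value 300 leaves room for
    the exponent 186 = 2 * 93 of [theta ^- 2]. *)
Lemma exponent_large : 300 * X <= c0 * tau ^+ 2 * m%:R.
Proof.
case/andP: eps01 => e0 _; have p_gt0 : 0 < p by exact: lt_le_trans p_ge1.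
have := ler_wpM2l (ltW (mulr_gt0 c0_gt0 (exprn_gt0 2 scaled_eps_gt0))) m_large.
apply: le_trans; rewrite le_eqVlt; apply/orP; left; apply/eqP.
by rewrite /X /tau; field; rewrite !gt_eqF.
Qed.

Let beta := 2 * expR (- (c0 * tau ^+ 2 * m%:R)).

Lemma beta_expR : beta <= expR (X - 300 * X).
Proof.
rewrite expRD; apply: ler_pM; rewrite ?expR_ge0//.
  by apply: le_trans (nat_le_expR (_ : (2 <= 2 ^ 1)%N)) _ => //; rewrite ler_expR exponent_ge1.
by rewrite ler_expR lerN2 exponent_large.
Qed.

Lemma delta4_expR : expR (- (3 * X)) <= delta / 4.
Proof.
have [_ _ hd] := parameters_expR; have X1 := exponent_ge1.
have lX : lam <= X.
  by rewrite /X ler_peMl ?(le_trans ler01 log_factor_ge1)// expr2 -[leLHS]mulr1 ler_pM ?p_ge1.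
rewrite ler_pdivlMr//; apply: le_trans hd.
apply: (@le_trans _ _ (expR (- (3 * X)) * expR 2%:R)).
  by rewrite ler_wpM2l ?expR_ge0//; exact: (@nat_le_expR 4 2).
by rewrite -expRD ler_expR; lra.
Qed.

Let nX : n%:R <= expR X.
Proof.
have [hn _ _] := parameters_expR; apply: le_trans hn _; rewrite ler_expR.
by rewrite /X ler_peMl ?(le_trans ler01 log_factor_ge1)// expr2 -[leLHS]mulr1 ler_pM ?p_ge1.
Qed.

Let twoX : 2 <= expR X.
Proof. by apply: le_trans (nat_le_expR (_ : (2 <= 2 ^ 1)%N)) _ => //; rewrite ler_expR exponent_ge1. Qed.

Let pX : p <= X.
Proof.
rewrite /X expr2 -mulrA ler_peMr ?(le_trans ler01 p_ge1)//.
by rewrite -[leLHS]mulr1 ler_pM ?p_ge1 ?log_factor_ge1.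
Qed.

Let iX : theta^-1 <= expR (93 * X).
Proof. by rewrite -[leRHS]invrK -expRN lef_pV2 ?posrE ?expR_gt0 ?sparsity_gt0 ?sparsity_expR. Qed.

Let beta_ge0 : 0 <= beta. Proof. by rewrite mulr_ge0// expR_ge0. Qed.

Let pow_le (k : nat) : k.+1%:R `^ p <= expR (k%:R * X).
Proof.
apply: (@le_trans _ _ (expR (k%:R * p))).
  rewrite expRM; apply: ler_powR2l => //; first exact: le_trans p_ge1.
  by rewrite -natr1 addrC; exact: expR_ge1Dx.
by rewrite ler_expR ler_wpM2l.
Qed.

Lemma anchor_pairs_failure : (n * n)%:R * beta <= delta / 4.
Proof.
apply: le_trans delta4_expR; rewrite natrM.
apply: (@le_trans _ _ (expR X * expR X * expR (X - 300 * X))).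
  by apply: ler_pM => //; [exact: ler_pM|exact: beta_expR].
by rewrite -!expRD ler_expR; have := exponent_ge1; lra.
Qed.

Lemma point_anchor_failure : 2 * 2 `^ p * n%:R / theta * beta <= delta / 4.
Proof.
apply: le_trans delta4_expR.
apply: (@le_trans _ _ (expR X * expR (1 * X) * expR X * expR (93 * X) * expR (X - 300 * X))).
  have i0 : 0 <= theta^-1 by rewrite invr_ge0 ltW// sparsity_gt0.
  have a0 : 0 <= 2 * 2 `^ p :> R := mulr_ge0 (ler0n _ 2) (powR_ge0 _ _).
  apply: ler_pM (mulr_ge0 (mulr_ge0 a0 (ler0n _ n)) i0) beta_ge0 _ beta_expR.
  apply: ler_pM (mulr_ge0 a0 (ler0n _ n)) i0 _ iX.
  apply: ler_pM a0 (ler0n _ n) _ nX.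
  exact: ler_pM (ler0n _ 2) (powR_ge0 _ _) twoX (pow_le 1).
by rewrite -!expRD ler_expR; have := exponent_ge1; lra.
Qed.

(** With [k = s + 1], the power [(s + 3) ^ p] is at most [expR (2 * k * X)], while the tail at
    stretch [k] is at most [2 * expR (- (300 * X * k))]. The terms thus decay geometrically; the
    tail bound for [t >= 1] enters here. *)
Lemma tail_failure (N : nat) : \sum_(0 <= s < N) 2 * s.+3%:R `^ p / theta *
  (2 * expR (- (c0 * s.+1%:R ^+ 2 * m%:R))) <= delta / 4.
Proof.
apply: le_trans delta4_expR; have X1 := exponent_ge1.
have i0 : 0 <= theta^-1 by rewrite invr_ge0 ltW// sparsity_gt0.
have tau1 : tau ^+ 2 <= 1.
  have p1 := p_ge1; case/andP: eps01 => e0 e1.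
  rewrite exprn_ile1 ?(ltW scaled_eps_gt0)// /tau ler_pdivrMr ?mulr_gt0 ?mul1r; lra.
have cm : 300 * X <= c0 * m%:R.
  apply: le_trans exponent_large _; rewrite ler_wpM2r// ler_piMr// ltW//.
apply: (@le_trans _ _ (\sum_(0 <= s < N) expR (- (3 * X)) * 2^-1 ^+ s.+1)); last first.
  by rewrite -mulr_sumr ler_piMr ?expR_ge0// sum_half_pow_le1.
apply: ler_sum => s _; set k := s.+1%:R : R.
have k1 : 1 <= k by rewrite ler1n.
apply: (@le_trans _ _ (expR X * expR (2 * k * X) * expR (93 * X) * (expR X * expR (- (300 * X * k))))).
  apply: ler_pM; rewrite ?mulr_ge0 ?expR_ge0 ?powR_ge0//.
    apply: ler_pM (mulr_ge0 (ler0n _ 2) (powR_ge0 _ _)) i0 _ iX.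
    apply: ler_pM (ler0n _ 2) (powR_ge0 _ _) twoX _.
    apply: le_trans (pow_le s.+2) _; rewrite ler_expR ler_wpM2r ?(le_trans ler01 X1)//.
    by rewrite -natr1 -/k; lra.
  have k0 : 0 <= k by lra.
  rewrite ler_pM ?expR_ge0// ler_expR lerN2.
  have -> : c0 * k ^+ 2 * m%:R = c0 * m%:R * k * k by ring.
  apply: le_trans (ler_wpM2r k0 cm) _.
  exact: ler_peMr (mulr_ge0 (mulr_ge0 (ltW c0_gt0) (ler0n _ m)) k0) k1.
apply: (@le_trans _ _ (expR (- (3 * X)) * expR (- k))).
  by rewrite -!expRD ler_expR; have := ler_wpM2r (le_trans ler01 X1) k1;
    have := ler_wpM2l (le_trans ler01 k1) X1; lra.
rewrite ler_wpM2l ?expR_ge0// expRN exprVn lef_pV2 ?posrE ?expR_gt0 ?exprn_gt0//.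
exact: pow2_le_expR.
Qed.

Lemma point_pairs_failure : theta ^- 2 * beta <= delta / 4.
Proof.
apply: le_trans delta4_expR; have i0 : 0 <= theta^-1 by rewrite invr_ge0 ltW// sparsity_gt0.
apply: (@le_trans _ _ (expR (93 * X) * expR (93 * X) * expR (X - 300 * X))).
  by rewrite -exprVn expr2; apply: ler_pM; rewrite ?mulr_ge0 ?beta_expR// ler_pM.
by rewrite -!expRD ler_expR; have := exponent_ge1; lra.
Qed.

End Constants.

(** * Comparison of the optimal costs *)

Section InfRange.
Variable R : realType.

Lemma ge0_inf_range_le (U : Type) (F : U -> R) u : (forall u, 0 <= F u) -> inf (range F) <= F u.
Proof.
move=> F0; apply: ge_inf; last by exists u.
by exists 0 => _ [v _ <-].
Qed.

Lemma ge0_le_inf_range (U : Type) (F : U -> R) (u0 : U) x :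
  (forall u, x <= F u) -> x <= inf (range F).
Proof.
move=> xF; apply: lb_le_inf; first by exists (F u0), u0.
by move=> _ [v _ <-].
Qed.

(** Attainment of the infima is avoided by taking an almost minimizer of [F], within
    [e / (2 * (1 + al))], so that its error costs at most [e / 2] after multiplication by [al]. *)
Lemma inf_range_transfer (U V : Type) (F : U -> R) (G : V -> R) (u0 : U) (al ka : R) :
  (forall u, 0 <= F u) -> (forall v, 0 <= G v) -> 0 <= al ->
  (forall u e, 0 < e -> exists v, G v <= al * F u + ka + e) ->
  inf (range G) <= al * inf (range F) + ka.
Proof.
move=> F0 G0 al0 h; apply/ler_addgt0Pr => e e0.
have e1 : 0 < e / (2 * (1 + al)) by rewrite divr_gt0// mulr_gt0//; lra.
have [|_ [u _ <-] Fu] := @inf_adherent R (range F) _ e1.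
  by split; [exists (F u0), u0|exists 0 => _ [v _ <-]].
have e2 : 0 < e / 2 by rewrite divr_gt0.
have [v Gv] := h u _ e2.
apply: le_trans (ge0_inf_range_le v G0) _; apply: le_trans Gv _.
have := ler_wpM2l al0 (ltW Fu).
have : al * (e / (2 * (1 + al))) <= e / 2.
  have -> : al * (e / (2 * (1 + al))) = al / (1 + al) * (e / 2) by field; rewrite gt_eqF//; lra.
  by rewrite ler_piMl ?(ltW e2)// ler_pdivrMr ?mul1r; lra.
lra.
Qed.

Lemma inf_rangeZ (U : Type) (F : U -> R) (u0 : U) (k : R) : 0 < k -> (forall u, 0 <= F u) ->
  inf (range (fun u => k * F u)) = k * inf (range F).
Proof.
move=> k0 F0; have kF0 u : 0 <= k * F u by rewrite mulr_ge0// ltW.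
apply/eqP; rewrite eq_le; apply/andP; split.
  rewrite -[leRHS]addr0; apply: inf_range_transfer => //; first exact: ltW.
  by move=> u e e0; exists u; rewrite addr0 lerDl ltW.
rewrite mulrC -ler_pdivlMr// mulrC -[leRHS]addr0.
apply: inf_range_transfer => //; first by rewrite invr_ge0 ltW.
by move=> u e e0; exists u; rewrite addr0 mulKf ?gt_eqF// lerDl ltW.
Qed.

End InfRange.

Definition min_value (R : realType) (I J : finType) (p : R) (d : nat) (w : J -> I -> R)
    (f : I -> 'rV[R]_d) : R := inf (range (value p w f)).

Lemma finite_argmin (R : realType) (K : finType) (k0 : K) (F : K -> R) :
  exists k, forall k', F k <= F k'.
Proof.
exists [arg min_(k < k0) F k]%O => k'.
by case: arg_minP => // k _ /(_ k' isT).
Qed.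

(** The anchors minimize over the finitely many choices of data points and assignments. Given
    centers [c], snapping each to its nearest data point at most doubles all distances, and
    reassigning points to nearest anchors costs nothing more. The choice precedes [w], [c] and the
    random matrix. *)
Lemma anchors_exist (R : realType) (I J : finType) (i0 : I) (j0 : J) (d : nat)
    (pts : I -> 'rV[R]_d) (a : I -> R) (p : R) :
  1 <= p ->
  exists (b : J -> I) (own : I -> J), forall (w : J -> I -> R) c, is_split a w ->
    2^-1 `^ p * anchor_cost pts b own a p <= value p w pts c.
Proof.
move=> p1; have p0 : 0 <= p by lra.
pose F (bo : {ffun J -> I} * {ffun I -> J}) :=
  \sum_x a x * enorm (pts x - pts (bo.1 (bo.2 x))) `^ p.
have [bo Fmin] := finite_argmin ([ffun=> i0], [ffun=> j0]) F.
exists bo.1, bo.2 => w c aw; have w0 := aw.1.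
have [near nearP] := choice (fun j => finite_argmin i0 (fun x => enorm (pts x - c j))).
have [sel selP] := choice (fun x => finite_argmin j0 (fun j => enorm (pts x - pts (near j)))).
have le : anchor_cost pts bo.1 bo.2 a p <= 2 `^ p * value p w pts c.
  apply: le_trans (Fmin ([ffun j => near j], [ffun x => sel x])) _.
  rewrite /F -(sum_split _ aw) /value mulr_sumr; apply: ler_sum => j _.
  rewrite mulr_sumr; apply: ler_sum => x _; rewrite mulrCA ler_wpM2l// !ffunE.
  rewrite -powRM ?enorm_ge0//; apply: ler_powR2l => //; first exact: enorm_ge0.
  apply: le_trans (selP x j) _; apply: le_trans (ler_enormB_trans (c j) _ _) _.
  by rewrite (enormBC (c j)); have := nearP j x; lra.
apply: le_trans (ler_wpM2l (powR_ge0 _ _) le) _.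
by rewrite mulrA -powRM// mulVf// powR1 mul1r.
Qed.

Section Sandwich.
Variables (R : realType) (d m : nat) (I J : finType) (pts : I -> 'rV[R]_d) (j0 : J).
Variables (b : J -> I) (own : I -> J) (a : I -> R) (eps p tau : R).
Hypotheses (eps01 : 0 < eps < 1) (p_ge1 : 1 <= p) (tau_gt0 : 0 < tau) (tp : tau * p = eps / 100).
Hypotheses (a_ge0 : forall x, 0 <= a x).
Variable B : 'M[R]_(d, m).
Hypothesis gB : good_matrix pts b own a tau (sparsity tau p #|J|) p B.

Lemma tau_le_half : tau <= 2^-1.
Proof.
have h : tau <= tau * p by rewrite ler_peMr// ltW.
by case/andP: eps01 => e0 e1; move: h; rewrite tp; lra.
Qed.

Lemma undistorted_le z : ~~ distorted tau z B -> enorm (z *m B) <= (1 + tau) * enorm z.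
Proof.
rewrite -leNgt => h; have := ler_norm (enorm (z *m B) - enorm z); lra.
Qed.

Lemma undistorted_ge z : ~~ distorted tau z B -> enorm z <= (1 + 2 * tau) * enorm (z *m B).
Proof.
rewrite -leNgt => h; have := ler_norm (enorm z - enorm (z *m B)); rewrite distrC => h1.
have z0 := enorm_ge0 z; have t2 := tau_le_half; have t0 := tau_gt0.
have zB : (1 - tau) * enorm z <= enorm (z *m B) by lra.
have c0 : 0 <= 1 + 2 * tau by lra.
apply: le_trans (ler_wpM2l c0 zB); rewrite mulrA -[leLHS]mul1r ler_wpM2r//.
have : 0 <= tau * (1 - 2 * tau) by rewrite mulr_ge0//; lra.
lra.
Qed.

Let pB x := pts x *m B.

Let goodP x l : good_point pts b tau B x -> ~~ distorted tau (pts x - pts (b l)) B.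
Proof. by move/forallP/(_ l). Qed.

Let le12 (z : 'rV[R]_d) : (1 + tau) * enorm z <= (1 + 2 * tau) * enorm z :> R.
Proof. by rewrite ler_wpM2r ?enorm_ge0//; have := tau_gt0; lra. Qed.

Lemma near_lip_fwd : near_lipschitz own b (anchor_dist pts b own) (good_point pts b tau B)
  (bad_edge pts tau B) tau pts pB.
Proof.
case: gB => gBB _ _ _; rewrite /near_lipschitz /pB; split.
- by move=> l l'; rewrite -mulmxBl; apply: le_trans (undistorted_le (gBB l l')) _.
- by move=> x l gx; have {}gx := goodP l gx; rewrite -mulmxBl; apply: le_trans (undistorted_le gx) _.
- by move=> x y _ _ gxy; rewrite -mulmxBl; apply: le_trans (undistorted_le gxy) _.
- by move=> x _; rewrite -/(anchor_dist pts b own x) ler_peMl// ?anchor_dist_ge0// ler1n.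
Qed.

Lemma anchor_dist_fwd x : good_point pts b tau B x -> enorm (pB x - pB (b (own x))) <= 2 * anchor_dist pts b own x.
Proof.
move=> gx; have {}gx := goodP (own x) gx; rewrite -mulmxBl; apply: le_trans (undistorted_le gx) _.
by rewrite ler_wpM2r ?enorm_ge0//; have := tau_le_half; lra.
Qed.

Lemma near_lip_bwd : near_lipschitz own b (anchor_dist pts b own) (good_point pts b tau B)
  (bad_edge pts tau B) tau pB pts.
Proof.
case: gB => gBB _ _ _; rewrite /near_lipschitz /pB; split.
- by move=> l l'; rewrite -mulmxBl; exact: undistorted_ge (gBB l l').
- by move=> x l gx; have {}gx := goodP l gx; rewrite -mulmxBl; exact: undistorted_ge.
- by move=> x y _ _ gxy; rewrite -mulmxBl; exact: undistorted_ge.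
- exact: anchor_dist_fwd.
Qed.

(** [value_distortion] is applied in both directions with the same distances [anchor_dist], measured
    before projection. Both errors are therefore fractions of the original cost. *)
Lemma min_value_sandwich (w : J -> I -> R) : is_split a w ->
  (forall c, 2^-1 `^ p * anchor_cost pts b own a p <= value p w pts c) ->
  (1 - eps) * min_value p w pts <= min_value p w pB <= (1 + eps) * min_value p w pts.
Proof.
move=> aw optle; case: (gB) => _ s1 s2 sp; case/andP: (eps01) => e0 e1.
have w0 := aw.1; have J0 : (0 < #|J|)%N by apply/card_gt0P; exists j0.
have optC : 2^-1 `^ p * anchor_cost pts b own a p <= min_value p w pts.
  exact: (ge0_le_inf_range (fun=> 0)).
have r0 := @anchor_dist_ge0 R d I J pts b own.
have fwd : min_value p w pB <= (1 + eps / 8) * min_value p w pts +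
    eps / 8 * (2^-1 `^ p * anchor_cost pts b own a p).
  apply: (inf_range_transfer (fun=> 0)); [by move=> c; exact: value_ge0..|lra|].
  move=> c e e_gt0.
  exact: (value_distortion j0 tau_gt0 tp eps01 p_ge1 J0 r0 a_ge0 c near_lip_fwd anchor_dist_fwd s1 s2 sp aw e_gt0).
have bwd : min_value p w pts <= (1 + eps / 8) * min_value p w pB +
    eps / 8 * (2^-1 `^ p * anchor_cost pts b own a p).
  apply: (inf_range_transfer (fun=> 0)); [by move=> c; exact: value_ge0..|lra|].
  move=> c e e_gt0.
  have own' x : good_point pts b tau B x -> enorm (pts x - pts (b (own x))) <= 2 * anchor_dist pts b own x.
    by move=> _; rewrite -/(anchor_dist pts b own x) ler_peMl// ler1n.
  exact: (value_distortion j0 tau_gt0 tp eps01 p_ge1 J0 r0 a_ge0 c near_lip_bwd own' s2 s1 sp aw e_gt0).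
have C0 : 0 <= min_value p w pts.
  by apply: (ge0_le_inf_range (fun=> 0)) => c; exact: value_ge0.
have e8 : 0 <= eps / 8 by lra.
have h := ler_wpM2l e8 optC.
move: (min_value p w pts) (min_value p w pB) C0 fwd bwd h => C C' C0 fwd bwd h.
have eC : 0 <= eps * C by rewrite mulr_ge0// ltW.
apply/andP; split; last by lra.
have pos : 0 < 1 + eps / 8 by lra.
(* The backward estimate reads [(1 - eps / 8) * C <= (1 + eps / 8) * C'], and
   [(1 - eps) * (1 + eps / 8) <= 1 - eps / 8]. *)
rewrite -(ler_pM2l pos); apply: (@le_trans _ _ ((1 - eps / 8) * C)); last by lra.
have : 0 <= eps * (eps * C) by rewrite mulr_ge0// ltW.
lra.
Qed.

End Sandwich.

(** * Stability under perturbation of the matrix *)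

Section Stability.
Variables (R : realType) (I J : finType) (p : R).
Hypothesis p_ge1 : 1 <= p.

Lemma min_value_move d a (w : J -> I -> R) (f f' : I -> 'rV[R]_d) (t : R) :
  is_split a w -> 0 < t <= 1 ->
  min_value p w f <= (1 + t) `^ p * min_value p w f'
                     + (2 / t) `^ p * \sum_x a x * enorm (f x - f' x) `^ p.
Proof.
move=> aw t01; have w0 := aw.1.
apply: (inf_range_transfer (fun=> 0)); [by move=> c; exact: value_ge0..|exact: powR_ge0|].
move=> c e e0; exists c; apply: le_trans (value_move p_ge1 f f' c aw t01) _.
by rewrite lerDl ltW.
Qed.

(** Both the factor [(1 + t) ^ p] and the error term use at most a quarter of the gap [y - x]. *)
Lemma powR_room (x y : R) : 0 <= x -> x < y -> exists t e : R,
  [/\ 0 < t <= 1, 0 < e & (1 + t) `^ p * x + (2 / t) `^ p * e < y].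
Proof.
move=> x0 xy; have p_gt0 : 0 < p by move: p_ge1; lra.
pose u := Num.min (2^-1) ((y - x) / (8 * (1 + x))).
have u0 : 0 < u by rewrite lt_min invr_gt0 ltr0n divr_gt0 ?mulr_gt0//; lra.
have u2 : u <= 2^-1 by rewrite ge_min lexx.
pose t := u / p; have t0 : 0 < t by rewrite divr_gt0.
have t1 : t <= 1 by rewrite ler_pdivrMr// mul1r; move: p_ge1; lra.
have T0 : 0 < (2 / t) `^ p by rewrite powR_gt0// divr_gt0.
exists t, ((y - x) / (4 * (2 / t) `^ p)); split.
- by rewrite t0.
- by rewrite divr_gt0 ?mulr_gt0//; lra.
have -> : (2 / t) `^ p * ((y - x) / (4 * (2 / t) `^ p)) = (y - x) / 4.
  by field; rewrite gt_eqF.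
have h : (1 + t) `^ p <= 1 + 2 * u.
  apply: le_trans (powR_1D_le (ltW t0) (ltW p_gt0)) _.
  by rewrite /t divfK ?gt_eqF//; apply: expR_le_1D2 => //; exact: ltW.
have h2 := ler_wpM2r x0 h.
have h3 : u * x <= (y - x) / 8.
  apply: (@le_trans _ _ ((y - x) / (8 * (1 + x)) * x)).
    by rewrite ler_wpM2r// ge_min lexx orbT.
  have -> : (y - x) / (8 * (1 + x)) * x = (y - x) / 8 * (x / (1 + x)).
    by field; rewrite gt_eqF//; lra.
  by rewrite ler_piMr ?ler_pdivrMr ?mul1r//; lra.
lra.
Qed.

Variables (d m : nat) (pts : I -> 'rV[R]_d).

Lemma proj_dist_cont (a : I -> R) (e : R) : (forall x, 0 <= a x) -> 0 < e ->
  exists2 r, 0 < r & forall B B' : 'M[R]_(d, m), (forall i j, `|B' i j - B i j| < r) ->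
    \sum_x a x * enorm (pts x *m B' - pts x *m B) `^ p <= e.
Proof.
move=> a0 e0; have p_gt0 : 0 < p by move: p_ge1; lra.
pose W := 1 + \sum_x a x.
have W0 : 0 < W by rewrite ltr_pwDl// sumr_ge0.
pose h := Num.min 1 (e / W).
have h0 : 0 < h by rewrite lt_min ltr01 divr_gt0.
have ex x : exists r, 0 < r /\ forall B B' : 'M[R]_(d, m), (forall i j, `|B' i j - B i j| < r) ->
    enorm (pts x *m B' - pts x *m B) < h.
  by have [r r0 hr] := @enorm_mul_cont R d m (pts x) h h0; exists r.
have [r rP] := choice ex.
have r0 x : 0 < r x := (rP x).1.
have S0 : 0 <= \sum_x (r x)^-1 by apply: sumr_ge0 => x _; rewrite invr_ge0 ltW.
(* A positive number below every [r x]. *)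
exists ((1 + \sum_x (r x)^-1)^-1) => [|B B' close]; first by rewrite invr_gt0; lra.
apply: (@le_trans _ _ (\sum_x a x * h)).
  apply: ler_sum => x _; rewrite ler_wpM2l//.
  have : enorm (pts x *m B' - pts x *m B) < h.
    apply: (rP x).2 => i j; apply: lt_le_trans (close i j) _.
    rewrite -[leRHS]invrK lef_pV2 ?posrE ?invr_gt0//; last lra.
    rewrite (bigD1 x)//= addrCA lerDl addr_ge0// sumr_ge0// => y _.
    by rewrite invr_ge0 ltW.
  move=> /ltW hx; apply: le_trans (ler_powR2l (ltW p_gt0) (enorm_ge0 _) hx) _.
  by rewrite ge1r_powR// h0 ge_min lexx.
rewrite -mulr_suml; apply: (@le_trans _ _ (W * h)).
  by rewrite ler_wpM2r ?(ltW h0)// /W lerDr.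
by rewrite mulrC -ler_pdivlMr// ge_min lexx orbT.
Qed.

(** A violation is strict and leaves room for the error of [min_value_move]. If the upper bound
    fails, [B] and [B'] exchange roles, since the perturbed value must then be bounded from
    below. *)
Lemma min_value_violation_open a (w : J -> I -> R) (lo hi : R) (B : 'M[R]_(d, m)) :
  is_split a w -> 0 <= hi -> (forall x, 0 <= a x) ->
  ~ (lo <= min_value p w (fun x => pts x *m B) <= hi) ->
  exists2 r, 0 < r & forall B' : 'M[R]_(d, m), (forall i j, `|B' i j - B i j| < r) ->
     ~ (lo <= min_value p w (fun x => pts x *m B') <= hi).
Proof.
move=> aw hi0 a0 /negP.
have g0 C : 0 <= min_value p w (fun x => pts x *m C : 'rV[R]_m).
  by apply: (ge0_le_inf_range (fun=> 0)) => c; apply: value_ge0; exact: aw.1.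
rewrite negb_and -!ltNge => /orP[lt|lt].
- have [t [e [t01 e0 room]]] := powR_room (g0 B) lt.
  have [r r0 hr] := proj_dist_cont a0 e0.
  exists r => // B' /hr cl /andP[h _]; move: h; apply/negP; rewrite -ltNge.
  apply: le_lt_trans room; apply: le_trans (min_value_move _ (fun x => pts x *m B) aw t01) _.
  by rewrite lerD2l ler_wpM2l ?powR_ge0.
- have [t [e [t01 e0 room]]] := powR_room hi0 lt.
  have [r r0 hr] := proj_dist_cont a0 e0.
  exists r => // B' cl /andP[_ h]; move: room; apply/negP; rewrite -leNgt.
  apply: le_trans (min_value_move _ (fun x => pts x *m B') aw t01) _.
  apply: lerD; first by rewrite ler_wpM2l ?powR_ge0.
  rewrite ler_wpM2l ?powR_ge0//; apply: hr => i j.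
  by rewrite distrC.
Qed.

End Stability.

(** * Solutions as weighted clusterings *)

Lemma big_finsupp_pred1 (R : realType) (T : choiceType) (g : mass_fun R T) (t : T) :
  \sum_(z <- finsupp g | z == t) g z = g t.
Proof.
have [tg|tg] := boolP (t \in finsupp g).
  by rewrite -big_filter (filter_pred1_uniq (fset_uniq _) tg) big_seq1.
rewrite big1_seq ?(fsfun_dflt tg)// => z /andP[/eqP -> zg].
by move: zg; rewrite (negbTE tg).
Qed.

Section Solution.
Variables (R : realType) (d n k : nat) (p : R) (mu : 'I_k -> mass_fun R 'rV[R]_d).

Definition all_points : {fset 'rV[R]_d} := \big[fsetU/fset0]_(i : 'I_k) finsupp (mu i).

Definition total_mass (x : all_points) : R := \sum_i mu i (val x).

(** A point shared by several supports is kept once with its weights added: its distance to a center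
    does not depend on the distribution it comes from. *)
Definition merged (w : weights R d n k) (j : 'I_n) (x : all_points) : R :=
  \sum_i w j i (val x).

Lemma solution_ge0 (w : weights R d n k) : is_solution p mu w -> forall j i x, 0 <= w j i x.
Proof. by move=> [nu [pt [g [_ _ _ gopt wE]]]] j i x; rewrite wE; case: (gopt i) => -[]. Qed.

(** The second marginal confines every atom of the coupling to some [pt j], and injectivity of [pt]
    makes [j] unique, so the first marginal splits over the [j]. *)
Lemma solution_sum (w : weights R d n k) : is_solution p mu w ->
  forall i x, \sum_j w j i x = mu i x.
Proof.
move=> [nu [pt [g [_ pt_inj supp gopt wE]]]] i x.
have [[g0 gmu gnu] _] := gopt i.
have atom z : z \in finsupp (g i) -> exists j, z.2 = pt j.
  move=> zg; apply: supp; rewrite mem_finsupp -gnu gt_eqF//.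
  rewrite big_mkcond (big_fsetD1 z)//= eqxx; apply: ltr_pwDl.
    by rewrite lt_neqAle g0 andbT eq_sym -mem_finsupp.
  by apply: sumr_ge0 => y _; case: ifP.
rewrite -gmu.
have -> : \sum_(z <- finsupp (g i) | z.1 == x) g i z =
    \sum_(z <- finsupp (g i) | z.1 == x) \sum_(j | z.2 == pt j) g i z.
  rewrite big_seq_cond [RHS]big_seq_cond; apply: eq_bigr => z /andP[zg zx]; have [j0 zj] := atom z zg.
  rewrite (big_pred1 j0)// => j; rewrite zj; apply/eqP/eqP => [/pt_inj->//|->//].
rewrite (exchange_big_dep xpredT)//=; apply: eq_bigr => j _.
rewrite wE -(big_finsupp_pred1 (g i) (x, pt j)); apply: eq_bigl => z.
by case: z => z1 z2; rewrite xpair_eqE.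
Qed.

Lemma solution_supp (w : weights R d n k) : is_solution p mu w ->
  forall j i x, x \notin finsupp (mu i) -> w j i x = 0.
Proof.
move=> sol j i x; rewrite memNfinsupp => /eqP; rewrite -(solution_sum sol) => /eqP.
rewrite psumr_eq0; last by move=> l _; exact: solution_ge0.
by move=> /allP /(_ j (mem_index_enum _)) /eqP.
Qed.

Lemma merged_split (w : weights R d n k) : is_solution p mu w -> is_split total_mass (merged w).
Proof.
move=> sol; split => [j x|x].
  by apply: sumr_ge0 => i _; exact: solution_ge0.
by rewrite /merged exchange_big/=; apply: eq_bigr => i _; exact: solution_sum.
Qed.

(** Each cluster may be enlarged to all the points, because the weight vanishes on those added. *)
Lemma cost_min_value (w : weights R d n k) m (f : 'rV[R]_d -> 'rV[R]_m) :
  (0 < k)%N -> is_solution p mu w ->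
  cost p mu w f = k%:R^-1 * min_value p (merged w) (fun x => f (val x)).
Proof.
move=> k0 sol; rewrite /min_value -inf_rangeZ; last 3 first.
- exact: (fun=> 0).
- by rewrite invr_gt0 ltr0n.
- by move=> c; apply: value_ge0; exact: (merged_split sol).1.
apply: (congr1 (fun F : ('I_n -> 'rV[R]_m) -> R => inf (range F))); apply/funext => c; congr (_ * _).
apply: eq_bigr => j _; rewrite /merged.
under [RHS]eq_bigr do rewrite mulr_suml.
rewrite exchange_big/=; apply: eq_bigr => i _.
rewrite -(big_seq_fsetE _ all_points xpredT (fun x => w j i x * enorm (f x - c j) `^ p))/=.
apply: big_fset_incl.
  apply/fsubsetP => x; rewrite !inE/= => /andP[xi _].
  by apply/bigfcupP; exists i => //; rewrite mem_index_enum.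
move=> x _; rewrite !inE/= negb_and => h.
suff -> : w j i x = 0 by rewrite mul0r.
case/orP: h => [|]; first exact: solution_supp.
rewrite -leNgt => w0; apply/eqP; rewrite eq_le w0; exact: solution_ge0.
Qed.

End Solution.

(** * Assembly of the probability bound *)

Theorem theorem4 (R : realType) (c0 : R) (c0_gt0 : 0 < c0) (q : {poly R}) :
  exists K : R, 0 < K /\
    forall (n d k m : nat) (eps delta p : R)
      (mu : 'I_k -> mass_fun R 'rV[R]_d)
      (disp : measure_display) (T : measurableType disp)
      (P : probability T R) (M : T -> 'M[R]_(d, m)),
      (1 <= n)%N -> (1 <= d)%N -> (1 <= k)%N ->
      0 < eps < 1 -> 0 < delta < 1 -> 1 <= p ->
      (forall i, is_distr (mu i)) ->
      (forall i, (#|` finsupp (mu i)|)%:R <= q.[n%:R]) ->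
      is_JL_map c0 P M ->
      K * (p ^+ 4 / eps ^+ 2 * Num.max 1 (ln (n%:R / (eps * delta)))) <= m%:R ->
      ((1 - delta)%:E <=
        P [set w | forall S : weights R d n k, is_solution p mu S ->
             ((1 - eps) * cost p mu S id
                <= cost p mu S (fun x => x *m M w)
                <= (1 + eps) * cost p mu S id)%R])%E.
Proof.
exists (3 * 10 ^+ 6 / c0); split; first by rewrite divr_gt0// mulr_gt0// exprn_gt0.
move=> n d k m eps delta p mu disp T P M n0 _ k0 eps01 delta01 p1 mu_distr _ JL m_large.
have kinv : 0 < k%:R^-1 :> R by rewrite invr_gt0 ltr0n.
have p_gt0 : 0 < p by exact: lt_le_trans p1.
pose a := @total_mass R d k mu; pose pts (x : all_points mu) : 'rV[R]_d := val x.
have a0 x : 0 <= a x by apply: sumr_ge0 => i _; case: (mu_distr i) => h _; exact: h.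
(* A data point exists because [mu i0] has mass 1; the search for anchors starts from it. *)
have [x0] : exists x0 : all_points mu, True.
  pose i0 : 'I_k := Ordinal k0.
  have [_ mass1] := mu_distr i0.
  have [s0|[x xs]] := fset_0Vmem (finsupp (mu i0)).
    by move: mass1; rewrite s0 big_seq_fset0 => /eqP; rewrite eq_sym oner_eq0.
  have xA : x \in all_points mu by apply/bigfcupP; exists i0 => //; rewrite mem_index_enum.
  by exists [` xA]%fset.
move=> _; pose j0 : 'I_n := Ordinal n0.
have [b [own optle]] := anchors_exist x0 j0 pts a p1.
have tau0 := scaled_eps_gt0 n0 eps01 delta01 p1.
have th0 := sparsity_gt0 n0 eps01 delta01 p1.
have f1 := anchor_pairs_failure c0_gt0 n0 eps01 delta01 p1 m_large.
have f2 := point_anchor_failure c0_gt0 n0 eps01 delta01 p1 m_large.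
have f3 := tail_failure c0_gt0 n0 eps01 delta01 p1 m_large.
have f4 := point_pairs_failure c0_gt0 n0 eps01 delta01 p1 m_large.
set tau := eps / (100 * p) in tau0 th0 f1 f2 f3 f4.
have tp : tau * p = eps / 100 by rewrite /tau; field; rewrite gt_eqF.
case/andP: (delta01) => d0 _.
have [||||G [mG PG GP]] := good_event JL pts b own a0 p1 th0 tau0 d0.
- by rewrite card_ord.
- by rewrite card_ord.
- exact: f3.
- exact: f4.
have condE (S : weights R d n k) (B : 'M[R]_(d, m)) : is_solution p mu S ->
    ((1 - eps) * cost p mu S id <= cost p mu S (fun x => x *m B) <= (1 + eps) * cost p mu S id) =
    ((1 - eps) * min_value p (merged S) pts <= min_value p (merged S) (fun x => pts x *m B)
      <= (1 + eps) * min_value p (merged S) pts).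
  move=> sol; rewrite !(cost_min_value _ k0 sol).
  by rewrite (mulrCA (1 - eps)) (mulrCA (1 + eps)) !ler_pM2l.
set U := [set w | _].
(* Monotonicity of [P] from [G] to [U] needs [U] measurable although it ranges over uncountably many
   solutions. Its complement is the preimage of a union of open sets of matrices, one for each
   solution, and such a union is open. *)
have mU : measurable U.
  pose V := [set B : 'M[R]_(d, m) | exists2 S : weights R d n k, is_solution p mu S &
    ~ ((1 - eps) * cost p mu S id <= cost p mu S (fun x => x *m B) <= (1 + eps) * cost p mu S id)].
  have -> : U = ~` [set t | V (M t)].
    apply/seteqP; split => [t Ut [S sol]|t nV S sol]; first by apply; exact: Ut.
    by apply: contrapT => h; apply: nV; exists S.
  apply: measurableC; apply: (measurable_open_preimage JL.1) => B [S sol].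
  rewrite condE// => viol.
  have aw := merged_split sol.
  have hi0 : 0 <= (1 + eps) * min_value p (merged S) pts.
    case/andP: (eps01) => e0 _; rewrite mulr_ge0//; first by rewrite addr_ge0// ltW.
    by apply: (ge0_le_inf_range (fun=> 0)) => c; apply: value_ge0; exact: aw.1.
  have [r r0 hr] := min_value_violation_open p1 aw hi0 a0 viol.
  by exists r => // B' /hr h; exists S => //; rewrite condE.
apply: le_trans PG _; apply: le_measure; rewrite ?inE//.
move=> t /GP gB S sol; rewrite condE//.
have gB' : good_matrix pts b own a tau (sparsity tau p #|'I_n|) p (M t) by rewrite card_ord.
apply: (min_value_sandwich j0 eps01 p1 tau0 tp a0 gB' (merged_split sol)) => c.
exact: optle (merged_split sol).
Qed.
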